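(* Let $\Omega$ be a Hausdorff space, $X$ be a complex Banach space, and $A$ be the base algebra of $A(\Omega,X)$. Suppose that the set $\rho A$ of strong peak points for $A$ is a norming subset of $\Omega$. If, for every $S\in\mathrm{Lip}_0(X,X)$, the range of the mapping $Q_S:A(\Omega,X)\to C_b(\Omega,X)$ given by $Q_S(f)(t)=S(f(t))$ ($f\in A(\Omega,X)$, $t\in\Omega$) is contained in $A(\Omega,X)$, then $n_L(X)=n_L(A(\Omega,X))$.
   Context: All Banach spaces are complex. $C_b(\Omega,X)$ is the Banach space of bounded continuous functions $\Omega\to X$ with the supremum norm, and $C_b(\Omega)=C_b(\Omega,\mathbb{C})$. A function algebra on $\Omega$ is a closed subspace (subalgebra) of $C_b(\Omega)$ that separates the points of $\Omega$ and contains the constants. $A(\Omega,X)$ denotes a closed subspace of $C_b(\Omega,X)$ such that: (i) the base algebra $A=\{x^*\circ f: f\in A(\Omega,X),\ x^*\in X^*\}$ is a function algebra; (ii) $A\otimes X\subset A(\Omega,X)$ (i.e. $t\mapsto\varphi(t)x$ is in $A(\Omega,X)$ for $\varphi\in A$, $x\in X$); (iii) $fg\in A(\Omega,X)$ for every $f\in A$, $g\in A(\Omega,X)$. A point $t_0\in\Omega$ is a strong peak point for $A$ if there is $f\in A$ with $|f(t_0)|=\|f\|_\infty$ and $\sup_{t\in\Omega\setminus U}|f(t)|<\|f\|_\infty$ for every open neighborhood $U$ of $t_0$; $\rho A$ is the set of strong peak points. $\rho A$ is norming if $\|f\|=\sup_{t\in\rho A}|f(t)|$ for all $f\in A$ (equivalently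 $\|f\|=\sup_{t\in\rho A}\|f(t)\|$ for all $f\in A(\Omega,X)$). For a Banach space $Z$, $\mathrm{Lip}_0(Z,Z)$ is the space of Lipschitz maps $T:Z\to Z$ with $T(0)=0$ and norm $\|T\|_L=\sup_{x\ne y}\|Tx-Ty\|/\|x-y\|$; $D(z)=\{z^*\in Z^*: z^*(z)=\|z^*\|\|z\|=\|z\|^2\}$; $\nu_L(T)=\sup\left\{\frac{|z^*(Tx-Ty)|}{\|x-y\|^2}: x\ne y \text{ in } Z,\ z^*\in D(x-y)\right\}$; and $n_L(Z)=\inf\{\nu_L(T): T\in\mathrm{Lip}_0(Z,Z),\ \|T\|_L=1\}$. *)

(* Defs.v *)
From HB Require Import structures.
From mathcomp Require Import all_boot all_order all_algebra.
From mathcomp Require Import all_classical all_reals all_analysis.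
From mathcomp.real_closed Require Import complex.
Set Implicit Arguments.
Unset Strict Implicit.
Unset Printing Implicit Defensive.
Import Order.TTheory GRing.Theory Num.Theory.
Import numFieldNormedType.Exports.
Local Open Scope classical_set_scope.
Local Open Scope complex_scope.
Local Open Scope ring_scope.

(* The library's norm on a normed module over R[i] takes values in R[i]
   (always real and nonnegative); suprema and infima are taken of its real
   part, which carries the same information (see rnormE). *)
Definition rnorm (R : realType) (V : normedModType R[i]) (x : V) : R :=
  complex.Re `|x|.

Section rnorm_theory.
Variables (R : realType) (V : normedModType R[i]).
Implicit Types x y : V.

Lemma rnormE x : (rnorm x)%:C = `|x|.
Proof.
have := normr_ge0 x; rewrite /rnorm; case: `|x| => a b.
by rewrite lecE /= => /andP[/eqP-> _].
Qed.

Lemma rnorm_ge0 x : 0 <= rnorm x.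
Proof. by rewrite -lecR rnormE normr_ge0. Qed.

Lemma rnormD x y : rnorm (x + y) <= rnorm x + rnorm y.
Proof. by rewrite -lecR rmorphD /= !rnormE ler_normD. Qed.

Lemma rnorm_eq0 x : rnorm x = 0 -> x = 0.
Proof. by move=> x0; apply/normr0_eq0; rewrite -rnormE x0. Qed.

Lemma rnorm0 : rnorm (0 : V) = 0.
Proof. by rewrite /rnorm normr0. Qed.

Lemma rnormZ (l : R[i]) x : rnorm (l *: x) = rnorm (l : R[i]^o) * rnorm x.
Proof. by apply: (@complexI R); rewrite rmorphM /= !rnormE normrZ. Qed.

Lemma bounded_funE (T : Type) (f : T -> V) :
  bounded_fun f <-> exists M : R, forall t, rnorm (f t) <= M.
Proof.
split=> [/pinfty_ex_gt0[M _ /= fM]|[M fM]].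
  by exists (complex.Re M) => t; have := fM t I; rewrite -rnormE lecE /= => /andP[].
exists M%:C; split; first by rewrite complex_real.
move=> N MN t _ /=; rewrite -rnormE (le_trans _ (ltW MN))// lecR.
exact: fM.
Qed.

End rnorm_theory.

Section bounded_continuous.
Variables (R : realType) (Omega : topologicalType) (X : normedModType R[i]).

Definition bcts : {pred Omega -> X} :=
  mem [set f : Omega -> X | continuous f /\ bounded_fun f].

Record Cb := MkCb { Cb_fun :> Omega -> X ; Cb_funP : Cb_fun \in bcts }.

HB.instance Definition _ := [isSub for Cb_fun].
HB.instance Definition _ := [Choice of Cb by <:].

Lemma bcts_submod_closed : submod_closed bcts.
Proof.
split.
  rewrite inE; split; first exact: cst_continuous.
  exact: bounded_cst.
move=> a f g; rewrite !inE => -[cf /bounded_funE[M fM]] [cg /bounded_funE[N gN]].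
split.
  move=> t; apply: cvgD; last exact: cg.
  by apply: cvgZl_tmp; exact: cf.
apply/bounded_funE; exists (rnorm (a : R[i]^o) * M + N) => t.
rewrite (le_trans (rnormD _ _))// lerD//.
by rewrite rnormZ ler_wpM2l ?rnorm_ge0.
Qed.

HB.instance Definition _ :=
  GRing.isSubmodClosed.Build R[i] (Omega -> X) bcts bcts_submod_closed.
HB.instance Definition _ := [SubChoice_isSubLmodule of Cb by <:].

Definition sup_norm (f : Cb) : R := sup [set rnorm (f t) | t in [set: Omega]].

Lemma Cb_bound (f : Cb) : exists M : R, forall t, rnorm (f t) <= M.
Proof.
by have := Cb_funP f; rewrite inE => -[_ /bounded_funE].
Qed.

Lemma rnorm_le_sup_norm (f : Cb) t : rnorm (f t) <= sup_norm f.
Proof.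
have [M fM] := Cb_bound f.
by apply: ub_le_sup; [exists M => _ [s _ <-]|exists t].
Qed.

Lemma sup_norm_le (f : Cb) (M : R) : 0 <= M ->
  (forall t, rnorm (f t) <= M) -> sup_norm f <= M.
Proof.
move=> M0 fM; have [ne|/nonemptyPn e] := pselect ([set: Omega] !=set0).
  by apply: ge_sup; [exact: image_nonempty|move=> _ [t _ <-]].
by rewrite /sup_norm e image_set0 sup0.
Qed.

Lemma sup_norm_ge0 (f : Cb) : 0 <= sup_norm f.
Proof.
have [[t _]|/nonemptyPn e] := pselect ([set: Omega] !=set0).
  exact: le_trans (rnorm_ge0 _) (rnorm_le_sup_norm f t).
by rewrite /sup_norm e image_set0 sup0.
Qed.

Let normCb (f : Cb) : R[i] := (sup_norm f)%:C.

Let ler_normCbD (f g : Cb) : normCb (f + g) <= normCb f + normCb g.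
Proof.
rewrite -rmorphD lecR; apply: sup_norm_le => [|t].
  by rewrite addr_ge0 ?sup_norm_ge0.
by rewrite (le_trans (rnormD _ _))// lerD// rnorm_le_sup_norm.
Qed.

Let normCb0 (f : Cb) : normCb f = 0 -> f = 0.
Proof.
move/complexI => f0; apply/val_inj/funext => t; apply/rnorm_eq0/eqP.
by rewrite eq_le rnorm_ge0 -[leRHS]f0 rnorm_le_sup_norm.
Qed.

Let normCbZ (l : R[i]) (f : Cb) : normCb (l *: f) = `|l| * normCb f.
Proof.
have le k g : sup_norm (k *: g) <= rnorm (k : R[i]^o) * sup_norm g.
  apply: sup_norm_le => [|t]; first by rewrite mulr_ge0 ?rnorm_ge0 ?sup_norm_ge0.
  by rewrite [leLHS]rnormZ ler_wpM2l ?rnorm_ge0 ?rnorm_le_sup_norm.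
rewrite -[`|l|](rnormE (l : R[i]^o)) -rmorphM; congr (_%:C).
apply/eqP; rewrite eq_le le/=.
have [->|l0] := eqVneq l 0; first by rewrite rnorm0 mul0r sup_norm_ge0.
have lp : 0 < rnorm (l : R[i]^o) by rewrite -ltcR rnormE normr_gt0.
rewrite -ler_pdivlMl//; have := le l^-1 (l *: f).
rewrite scalerA mulVf// scale1r => /le_trans; apply.
apply: ler_wpM2r; first exact: sup_norm_ge0.
suff -> : rnorm (l^-1 : R[i]^o) = (rnorm (l : R[i]^o))^-1 by [].
by apply: (@complexI R); rewrite fmorphV !rnormE normfV.
Qed.

HB.instance Definition _ :=
  Lmodule_isNormed.Build R[i] Cb ler_normCbD normCbZ normCb0.

Lemma rnorm_CbE (f : Cb) : rnorm f = sup_norm f.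
Proof. by []. Qed.

End bounded_continuous.

(* The carrier cs_type S of a closed subspace S is a normed module of its own
   for the restricted norm, so that notions about a normed space (dual,
   Lipschitz self-maps) apply to S and do not refer to the ambient space. *)
Record closed_subspace (R : realType) (V : normedModType R[i]) := ClosedSubspace {
  cs_set :> set V ;
  cs_submod : submod_closed (mem cs_set) ;
  cs_closed : closed cs_set }.

Section subspace_norm.
Variables (R : realType) (V : normedModType R[i]) (S : closed_subspace V).

Definition cs_pred : {pred V} := mem (cs_set S).

HB.instance Definition _ :=
  GRing.isSubmodClosed.Build R[i] V cs_pred (cs_submod S).

Record cs_type := MkCs { cs_val : V ; cs_valP : cs_val \in cs_pred }.

HB.instance Definition _ := [isSub for cs_val].
HB.instance Definition _ := [Choice of cs_type by <:].
HB.instance Definition _ := [SubChoice_isSubLmodule of cs_type by <:].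

Let normS (x : cs_type) : R[i] := `|cs_val x|.

Let ler_normSD x y : normS (x + y) <= normS x + normS y.
Proof. exact: ler_normD. Qed.

Let normSZ (l : R[i]) x : normS (l *: x) = `|l| * normS x.
Proof. exact: normrZ. Qed.

Let normS0 x : normS x = 0 -> x = 0.
Proof. by move/normr0_eq0 => x0; exact: val_inj. Qed.

HB.instance Definition _ :=
  Lmodule_isNormed.Build R[i] cs_type ler_normSD normSZ normS0.

End subspace_norm.

(* A set of bounded continuous functions, viewed as a set of plain functions. *)
Definition functions_of (R : realType) (Omega : topologicalType)
    (X : normedModType R[i]) (B : set (Cb Omega X)) : set (Omega -> X) :=
  [set g : Omega -> X | exists2 f, B f & Cb_fun f = g].

Section function_spaces.
Variables (R : realType) (Omega : topologicalType).
Local Notation CbC := (Cb Omega R[i]^o).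

Definition function_algebra (B : set CbC) : Prop :=
  [/\ submod_closed (mem B) /\ closed B,
      (forall f g, B f -> B g -> functions_of B (fun t => f t * g t)),
      (forall s t : Omega, s <> t -> exists2 f, B f & f s <> f t) &
      (forall c : R[i]^o, functions_of B (cst c))].

(* When U = setT the supremum below is sup set0 = 0 and the condition reads
   f <> 0. *)
Definition strong_peak_point (B : set CbC) (t0 : Omega) : Prop :=
  exists f : CbC,
    [/\ B f, rnorm (f t0) = rnorm f &
        forall U : set Omega, open U -> U t0 ->
          sup [set rnorm (f t) | t in ~` U] < rnorm f].

Definition rho (B : set CbC) : set Omega := [set t | strong_peak_point B t].

Definition norming (B : set CbC) (D : set Omega) : Prop :=
  forall f : CbC, B f -> rnorm f = sup [set rnorm (f t) | t in D].

Variable X : normedModType R[i].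

Definition base_algebra (A : set (Cb Omega X)) : set CbC :=
  [set phi : CbC | exists f (xs : {linear X -> R[i]^o}),
    [/\ A f, continuous xs & forall t, phi t = xs (f t)]].

Definition vector_function_space (A : set (Cb Omega X)) : Prop :=
  [/\ function_algebra (base_algebra A),
      (forall phi x, base_algebra A phi ->
         functions_of A (fun t => phi t *: x)) &
      (forall phi g, base_algebra A phi -> A g ->
         functions_of A (fun t => phi t *: g t))].

End function_spaces.

(* The suprema and infima below are those of R, with the convention that they
   are 0 on the empty set; empty sets only occur when Z = 0. For T in Lip0 and
   continuous linear zs all these sets are bounded. *)
Section lipschitz_index.
Variables (R : realType) (Z : normedModType R[i]).

Definition Lip0 : set (Z -> Z) := [set T : Z -> Z | T 0 = 0 /\ lipschitz T].

Definition lip_norm (T : Z -> Z) : R :=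
  sup [set r | exists x y, x <> y /\ r = rnorm (T x - T y) / rnorm (x - y)].

Definition dual_norm (zs : Z -> R[i]^o) : R :=
  sup [set rnorm (zs z) | z in [set z | rnorm z <= 1]].

Definition duality_map (z : Z) : set {linear Z -> R[i]^o} :=
  [set zs : {linear Z -> R[i]^o} |
    [/\ continuous zs, zs z = (dual_norm zs * rnorm z)%:C &
        dual_norm zs * rnorm z = rnorm z ^+ 2]].

Definition lip_radius (T : Z -> Z) : R :=
  sup [set r | exists x y zs, [/\ x <> y, duality_map (x - y) zs &
                 r = rnorm (zs (T x - T y)) / rnorm (x - y) ^+ 2]].

Definition lip_index : R :=
  inf [set lip_radius T | T in [set T | Lip0 T /\ lip_norm T = 1]].

End lipschitz_index.

Arguments lip_index {R} Z.

(* The operator Q_S f = S \o f. *)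
Definition Qop (R : realType) (Omega : topologicalType)
    (X : normedModType R[i]) (S : X -> X) (f : Cb Omega X) : Omega -> X :=
  fun t => S (f t).

(* Main.v *)
(* For [n_L(A(Omega,X)) <= n_L(X)], a Lipschitz map [S] of [X] induces
   [T f := S \o f] with the same Lipschitz norm.  Pointwise, the Lumer-type
   estimate [(1 - |a| nu(S)) |x - y + a (S x - S y)| <= (1 + |a|^2 L^2) |x - y|]
   holds; taking suprema over [Omega] and letting [a -> 0] gives
   [nu(T) <= nu(S)].

   For the converse, let [t0] be a strong peak point.  Iterating
   [z |-> 1 - sqrt (1 - z)] on a peak function produces [phi] in the base
   algebra, concentrated near [t0], with [phi(t0) = 1] and
   [|phi| + (1 - e) |1 - phi| <= 1].  Given [h] with [|h| <= 1] and a unit vector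
   [p] with norming functional [xs], [Psi x := phi x + (1 - e) xs(x) (1 - phi) h]
   is an isometric linear section of the evaluation at [t0], and
   [S x := (T (k + Psi x) - T k)(t0)] has [nu(S) <= nu(T)]; this bounds
   [n_L(X) |(T (k + l Psi p) - T k)(t0)|] by [nu(T) l].  Up to [O(e)], an arbitrary
   increment [f - g] is the sum of two increments of this form, along [p] and
   [- p], of total length [|f - g|], whence [n_L(X) |T|_L <= nu(T)]. *)
From HB Require Import structures.
Require Import Defs.
From mathcomp Require Import all_boot all_order all_algebra.
From mathcomp Require Import all_classical all_reals all_analysis.
From mathcomp.real_closed Require Import complex.
From mathcomp Require Import ring lra.
Set Implicit Arguments.
Unset Strict Implicit.
Unset Printing Implicit Defensive.
Import Order.TTheory GRing.Theory Num.Theory.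
Import numFieldNormedType.Exports.
Local Open Scope classical_set_scope.
Local Open Scope complex_scope.
Local Open Scope ring_scope.

(** * Real-valued norms *)
Section rnorm_extra.
Context {R : realType}.

Lemma rnormN (V : normedModType R[i]) (x : V) : rnorm (- x) = rnorm x.
Proof. by rewrite /rnorm normrN. Qed.

Lemma rnorm_distC (V : normedModType R[i]) (x y : V) : rnorm (x - y) = rnorm (y - x).
Proof. by rewrite -rnormN opprB. Qed.

Lemma rnormB_le (V : normedModType R[i]) (x y : V) :
  rnorm (x - y) <= rnorm x + rnorm y.
Proof. by rewrite (le_trans (rnormD _ _))// rnormN. Qed.

Lemma rnorm_gt0 (V : normedModType R[i]) (x : V) : (0 < rnorm x) = (x != 0).
Proof. by rewrite -ltcR rnormE normr_gt0. Qed.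

Lemma rnormM (z w : R[i]) : rnorm (z * w : R[i]^o) = rnorm (z : R[i]^o) * rnorm (w : R[i]^o).
Proof. exact: (rnormZ z (w : R[i]^o)). Qed.

Lemma rnormX (z : R[i]) n : rnorm (z ^+ n : R[i]^o) = rnorm (z : R[i]^o) ^+ n.
Proof. by apply: (@complexI R); rewrite rmorphXn /= !rnormE normrX. Qed.

Lemma rnorm_real (r : R) : rnorm (r%:C : R[i]^o) = `|r|.
Proof. by rewrite /rnorm normc_def /= expr0n addr0 sqrtr_sqr. Qed.

Lemma rnorm1 : rnorm (1 : R[i]^o) = 1.
Proof. by rewrite (rnorm_real 1) normr1. Qed.

Lemma sqr_rnorm (z : R[i]) :
  rnorm (z : R[i]^o) ^+ 2 = complex.Re z ^+ 2 + complex.Im z ^+ 2.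
Proof. by rewrite /rnorm normc_def /= sqr_sqrtr ?addr_ge0 ?sqr_ge0. Qed.

Lemma Re_le_rnorm (z : R[i]) : `|complex.Re z| <= rnorm (z : R[i]^o).
Proof. by rewrite -lecR rnormE normc_ge_Re. Qed.

Lemma rnormZr (V : normedModType R[i]) (r : R) (x : V) :
  rnorm (r%:C *: x) = `|r| * rnorm x.
Proof. by rewrite rnormZ rnorm_real. Qed.

Lemma rnorm_phase (z : R[i]) :
  exists2 c : R[i], rnorm (c : R[i]^o) = 1 & c * z = (rnorm (z : R[i]^o))%:C.
Proof.
have [->|z0] := eqVneq z 0; first by exists 1; rewrite ?rnorm1 ?mulr0 ?rnorm0.
have rz : rnorm (z : R[i]^o) != 0 by rewrite gt_eqF// rnorm_gt0.
have rzC : (rnorm (z : R[i]^o))%:C != 0 by rewrite rnormE normr_eq0.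
exists ((rnorm (z : R[i]^o))%:C / z); last by rewrite divfK.
rewrite rnormM rnorm_real ger0_norm ?rnorm_ge0//.
have <- : (rnorm (z : R[i]^o))^-1 = rnorm (z^-1 : R[i]^o).
  by apply: (@complexI R); rewrite fmorphV /= !rnormE normfV.
by rewrite divff.
Qed.

End rnorm_extra.

Lemma linear_of_fun (K : nzRingType) (U : lmodType K) (W : lmodType K)
  (f : U -> W) : linear f -> exists g : {linear U -> W}, forall x, g x = f x.
Proof.
move=> lf.
pose H := GRing.isLinear.Build K U W *:%R f lf.
pose g : {linear U -> W} := HB.pack f H.
by exists g.
Qed.

(** * The complex Hahn-Banach theorem *)
Section hahn_banach.
Context {R : realType} {V : lmodType R[i]}.
Implicit Types p q : V -> R.

(** Scalars are real numbers embedded in the complex field, so [V] is treated as a real space.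
    Homogeneity is asked only as an inequality; [sublinearZ] recovers equality by applying it to
    [t^-1]. *)
Definition sublinear q :=
  (forall x y, q (x + y) <= q x + q y) /\
  (forall (t : R) x, 0 <= t -> q (t%:C *: x) <= t * q x).

Lemma sublinearZ q (t : R) x : sublinear q -> 0 <= t -> q (t%:C *: x) = t * q x.
Proof.
move=> [qD qZ]; rewrite le_eqVlt => /predU1P[<-|t0]; last first.
  apply/eqP; rewrite eq_le (qZ _ _ (ltW t0))/= -ler_pdivlMl//.
  have := qZ t^-1 (t%:C *: x); rewrite scalerA -rmorphM mulVf ?gt_eqF// scale1r.
  by apply; rewrite invr_ge0 ltW.
rewrite scale0r mul0r; apply/eqP; rewrite eq_le; apply/andP; split.
  by have := qZ 0 0 (lexx _); rewrite scale0r mul0r.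
by have := qD 0 0; rewrite addr0 lerDl.
Qed.

Lemma sublinear0 q : sublinear q -> q 0 = 0.
Proof. by move=> sq; rewrite -(scale0r (0 : V)) (sublinearZ _ sq)// mul0r. Qed.

Lemma sublinearN q x : sublinear q -> - q (- x) <= q x.
Proof.
move=> sq; have := sq.1 x (- x); rewrite subrr (sublinear0 sq); lra.
Qed.

Definition lower q (y x : V) : R :=
  inf [set q (x + t%:C *: y) - t * q y | t in [set t | 0 <= t]].

Lemma lower_le q y x t : sublinear q -> 0 <= t ->
  lower q y x <= q (x + t%:C *: y) - t * q y.
Proof.
move=> sq t0; apply: ge_inf; last by exists t.
(* The set is bounded below, as [s * q y = q (s y) <= q (- x) + q (x + s y)]. *)
exists (- q (- x)) => _ [s /= s0 <-].
have := sq.1 (- x) (x + s%:C *: y); rewrite addKr (sublinearZ _ sq)//; lra.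
Qed.

Lemma le_lower q y x (m : R) :
  (forall t, 0 <= t -> m <= q (x + t%:C *: y) - t * q y) -> m <= lower q y x.
Proof.
move=> h; apply: lb_le_inf; first by apply: image_nonempty; exists 0; rewrite /= lexx.
by move=> _ [t /= t0 <-]; exact: h.
Qed.

Lemma lower_le_self q y x : sublinear q -> lower q y x <= q x.
Proof.
move=> sq; apply: le_trans (lower_le y x sq (lexx _)) _.
by rewrite scale0r addr0 mul0r subr0.
Qed.

(** Parameters [t] for [x] and [s] for [x'] combine into [t + s] for [x + x']; a parameter [t] for
    [x] becomes [s * t] for [s x]. *)
Lemma sublinear_lower q y : sublinear q -> sublinear (lower q y).
Proof.
move=> sq; split.
  move=> x x'; rewrite -lerBlDr; apply: le_lower => t t0.
  rewrite lerBlDr -lerBlDl; apply: le_lower => s s0; rewrite lerBlDl.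
  apply: le_trans (lower_le y (x + x') sq (addr_ge0 t0 s0)) _.
  rewrite rmorphD /= scalerDl addrACA.
  have := sq.1 (x + t%:C *: y) (x' + s%:C *: y); lra.
move=> s x; rewrite le_eqVlt => /predU1P[<-|s0].
  rewrite mul0r scale0r; apply: le_trans (lower_le_self y 0 sq) _.
  by rewrite sublinear0.
rewrite -ler_pdivrMl//; apply: le_lower => t t0.
rewrite ler_pdivrMl//.
apply: le_trans (lower_le y _ sq (mulr_ge0 (ltW s0) t0)) _.
rewrite rmorphM /= -scalerA -scalerDr (sublinearZ _ sq (ltW s0)); lra.
Qed.

(** Lower bounds of chains for Zorn's lemma. The values at [x] are bounded below by [- p (- x)], and
    of two members of the chain the smaller one serves both summands in subadditivity. *)
Lemma sublinear_inf (F : set (V -> R)) p : F !=set0 ->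
  (forall q, F q -> sublinear q /\ forall x, q x <= p x) ->
  (forall q r, F q -> F r -> (forall x, q x <= r x) \/ (forall x, r x <= q x)) ->
  sublinear (fun x => inf [set q x | q in F]) /\
  forall q, F q -> forall x, inf [set q x | q in F] <= q x.
Proof.
move=> F0 Fs Ftot.
have infle q x : F q -> inf [set q x | q in F] <= q x.
  move=> Fq; apply: ge_inf; last by exists q.
  exists (- p (- x)) => _ [r Fr <-]; have [sr rp] := Fs r Fr.
  by have := sublinearN x sr; have := rp (- x); lra.
have leinf m x : (forall q, F q -> m <= q x) -> m <= inf [set q x | q in F].
  move=> h; apply: lb_le_inf; first exact: image_nonempty.
  by move=> _ [q Fq <-]; exact: h.
split; last by move=> q Fq x; exact: infle.
split.
  move=> x y; rewrite -lerBlDr; apply/leinf => q Fq.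
  rewrite lerBlDr -lerBlDl; apply/leinf => r Fr; rewrite lerBlDl.
  have [qr|rq] := Ftot q r Fq Fr.
    apply: le_trans (infle q _ Fq) _; apply: le_trans ((Fs q Fq).1.1 _ _) _.
    by rewrite lerD2l.
  apply: le_trans (infle r _ Fr) _; apply: le_trans ((Fs r Fr).1.1 _ _) _.
  by rewrite lerD2r.
move=> t x; rewrite le_eqVlt => /predU1P[<-|t0].
  have [q Fq] := F0; rewrite mul0r scale0r; apply: le_trans (infle q _ Fq) _.
  by rewrite sublinear0//; exact: (Fs q Fq).1.
rewrite -ler_pdivrMl//; apply/leinf => q Fq; rewrite ler_pdivrMl//.
by apply: le_trans (infle q _ Fq) _; exact: ((Fs q Fq).1.2 _ _ (ltW t0)).
Qed.

(* Sublinear functionals that are minimal for the pointwise order are linear: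
   minimality makes [lower q y] equal to [q], whence additivity. *)
Lemma sublinear_minorant p : sublinear p ->
  exists f : V -> R, [/\ forall x, f x <= p x,
    forall x y, f (x + y) = f x + f y & forall (t : R) x, f (t%:C *: x) = t * f x].
Proof.
move=> sp.
pose T := {q : V -> R | sublinear q /\ forall x, q x <= p x}.
(* The order is reversed, so a maximal element for [ord] is a minimal sublinear functional. *)
pose ord (q r : T) := `[< forall x, proj1_sig r x <= proj1_sig q x >].
pose mk q (bq : sublinear q /\ forall x, q x <= p x) : T := exist _ q bq.
have t0 : T by exists p.
have [||F Ftot|[q [sq qp]] qmin] := @ZL_preorder T t0 ord.
- by move=> t; apply/asboolP.
- move=> r s t /asboolP rs /asboolP st; apply/asboolP => x.
  exact: le_trans (st x) (rs x).
- have [[q0 Fq0]|F0] := pselect (F !=set0); last first.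
    by exists t0 => s Fs; case: F0; exists s.
  pose G := [set proj1_sig q | q in F].
  have [|||sG Gle] := @sublinear_inf G p.
  + by exists (proj1_sig q0), q0.
  + by move=> _ [q _ <-]; exact: (proj2_sig q).
  + move=> _ _ [q Fq <-] [r Fr <-].
    by case: (Ftot q r Fq Fr) => /asboolP; [right|left].
  have bnd : sublinear (fun x => inf [set q x | q in G]) /\
             forall x, inf [set q x | q in G] <= p x.
    split=> // x; apply: le_trans (Gle (proj1_sig q0) _ x) _; first by exists q0.
    by have [_] := proj2_sig q0; apply.
  exists (mk _ bnd) => s Fs; apply/asboolP => x /=.
  by apply: Gle; exists s.
have qD x y : q (x + y) = q x + q y.
  apply/eqP; rewrite eq_le sq.1 /=.
  have bnd : sublinear (lower q y) /\ forall x, lower q y x <= p x.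
    split; first exact: sublinear_lower.
    by move=> z; apply: le_trans (lower_le_self y z sq) (qp z).
  have /asboolP /(_ x) /= := qmin (mk _ bnd)
    (asboolT (fun z => lower_le_self y z sq)).
  by have := lower_le y x sq ler01; rewrite scale1r mul1r; lra.
have qN x : q (- x) = - q x.
  by apply/eqP; rewrite -addr_eq0 -qD addNr sublinear0.
exists q; split=> [x|x y|t x]; [exact: qp|exact: qD|].
have [t_ge0|t_lt0] := leP 0 t; first exact: sublinearZ.
rewrite -[t]opprK rmorphN /= scaleNr qN (sublinearZ _ sq) ?oppr_ge0 ?ltW//.
by rewrite !mulNr.
Qed.

End hahn_banach.

(** A real-linear [f] below [lower rnorm x0] is dominated by the norm and equals it at [x0]. Its
    complexification [w |-> f w - i f (i w)] is the functional sought. *)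
Lemma norming_functional {R : realType} {V : normedModType R[i]} (x0 : V) :
  exists zs : {linear V -> R[i]^o},
    (forall w, rnorm (zs w) <= rnorm w) /\ zs x0 = (rnorm x0)%:C.
Proof.
have sr : sublinear (@rnorm R V).
  split=> [x y|t x t0]; first exact: rnormD.
  by rewrite rnormZr ger0_norm.
have [f [fle fD fZ]] := sublinear_minorant (sublinear_lower x0 sr).
have fN x : f (- x) = - f x.
  by have := fZ (-1) x; rewrite rmorphN rmorph1 scaleN1r mulN1r.
have fx0 : rnorm x0 <= f x0.
  have := lower_le x0 (- x0) sr ler01; have := fle (- x0).
  by rewrite fN scale1r addNr rnorm0; lra.
have frn x : f x <= rnorm x.
  by apply: le_trans (fle x) _; exact: lower_le_self.
have lin : linear (fun w : V => (f w +i* (- f ('i *: w)%R) : R[i]^o)).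
  move=> k u v; rewrite scalerDr !fD.
  have aux (z : V) (c : R[i]) : f (c *: z) = complex.Re c * f z + complex.Im c * f ('i *: z)%R.
    rewrite -!fZ -fD scalerA -scalerDl; congr (f (_ *: z)).
    by rewrite mulrC -complexE.
  have addE (a b c d : R) : ((a +i* b : R[i]^o) + (c +i* d) = (a + c) +i* (b + d))%R by [].
  have mulE (a b c d : R) :
    (a +i* b) *: (c +i* d : R[i]^o) = (a * c - b * d) +i* (a * d + b * c) by [].
  rewrite scalerA (aux u k) (aux u ('i * k)); case: k => a b; rewrite mulE addE.
  have [-> ->] : complex.Re ('i * (a +i* b)) = - b /\ complex.Im ('i * (a +i* b)) = a.
    by split; rewrite mulrC ?ReiNIm ?ImiRe.
  congr (_ +i* _); rewrite /=; ring.
have [zs zsE] := linear_of_fun lin.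
have zsb w : rnorm (zs w) <= rnorm w.
  (* Rotating [w] makes [zs w] real and nonnegative, where it coincides with [f]. *)
  have [c c1 cz] := rnorm_phase (zs w).
  have cw : zs (c *: w) = c * zs w by rewrite linearZ.
  have := frn (c *: w); rewrite rnormZ c1 mul1r; apply: le_trans.
  by have := congr1 (@complex.Re R) (etrans cw cz); rewrite zsE /= => ->.
exists zs; split=> //.
have := zsb x0; rewrite -(ler_pXn2r (ltn0Sn 1)) ?nnegrE ?rnorm_ge0// sqr_rnorm.
rewrite zsE /=; set a := f x0; set b := - f _ => h.
have a2 : rnorm x0 ^+ 2 <= a ^+ 2 by rewrite ler_pXn2r ?nnegrE ?rnorm_ge0// (le_trans _ fx0)// rnorm_ge0.
(* Since [a ^+ 2 + b ^+ 2 <= rnorm x0 ^+ 2 <= a ^+ 2], the imaginary part vanishes. *)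
have b0 : b = 0.
  by apply/eqP; rewrite -sqrf_eq0 eq_le sqr_ge0 andbT; lra.
by rewrite b0; congr (_ +i* _); apply/eqP; rewrite eq_le frn fx0.
Qed.

(** * Duality map, Lipschitz norm and Lipschitz numerical radius *)
Section lipschitz_maps.
Context {R : realType} {Z : normedModType R[i]}.
Implicit Types (T : Z -> Z) (x y z : Z).

Lemma dominated_linear_continuous (W : normedModType R[i]) (f : {linear Z -> W}) (M : R) :
  (forall w, rnorm (f w) <= M * rnorm w) -> continuous f.
Proof.
move=> fM; apply/bounded_linear_continuous/linear_boundedP.
exists M%:C; split; first by rewrite complex_real.
move=> N MN w; rewrite -!rnormE.
apply: (@le_trans _ _ (M%:C * (rnorm w)%:C)); first by rewrite -rmorphM lecR.
by rewrite ler_wpM2r// ?ler0c ?rnorm_ge0// ltW.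
Qed.

Lemma lipschitzP T : lipschitz T <->
  exists2 M : R, 0 <= M & forall x y, rnorm (T x - T y) <= M * rnorm (x - y).
Proof.
split=> [/pinfty_ex_gt0[M M0 TM]|[M M0 TM]].
  have MR : (complex.Re M)%:C = M by rewrite RRe_real// gtr0_real.
  exists (complex.Re M) => [|x y]; first by rewrite -ler0c MR ltW.
  rewrite -lecR rmorphM /= MR !rnormE.
  exact: (TM (x, y) (conj Logic.I Logic.I)).
exists M%:C; split; first by rewrite complex_real.
move=> N MN [x y] _ /=; rewrite -!rnormE.
apply: (@le_trans _ _ (M%:C * (rnorm (x - y))%:C)); first by rewrite -rmorphM lecR.
by rewrite ler_wpM2r// ?ler0c ?rnorm_ge0// ltW.
Qed.

Lemma dual_norm_le (zs : {linear Z -> R[i]^o}) (M : R) : 0 <= M ->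
  (forall w, rnorm (zs w) <= M * rnorm w) -> dual_norm zs <= M.
Proof.
move=> M0 zsM; apply: ge_sup.
  by apply: image_nonempty; exists 0; rewrite /= rnorm0.
by move=> _ [w /= w1 <-]; rewrite (le_trans (zsM w))// ler_piMr.
Qed.

Lemma rnorm_le_dual_norm (zs : {linear Z -> R[i]^o}) w : continuous zs ->
  rnorm (zs w) <= dual_norm zs * rnorm w.
Proof.
move=> /(_ 0)/continuous_linear_bounded/linear_boundedP/pinfty_ex_gt0[M M0 zsM].
have MR : (complex.Re M)%:C = M by rewrite RRe_real// gtr0_real.
have [->|w0] := eqVneq w 0; first by rewrite linear0 !rnorm0 mulr0.
have w_gt0 : 0 < rnorm w by rewrite rnorm_gt0.
have ub : has_ubound [set rnorm (zs w) | w in [set w | rnorm w <= 1]].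
  exists (complex.Re M) => _ [v /= v1 <-].
  rewrite (@le_trans _ _ (complex.Re M * rnorm v))//.
    by rewrite -lecR rmorphM /= MR !rnormE.
  by rewrite ler_piMr// -ler0c MR ltW.
rewrite -ler_pdivrMr//; apply: (ub_le_sup ub).
exists (((rnorm w)^-1)%:C *: w).
  by rewrite /= rnormZr ger0_norm ?invr_ge0 ?rnorm_ge0// mulVf// gt_eqF.
by rewrite linearZ/= [LHS]rnormZr ger0_norm ?invr_ge0 ?rnorm_ge0// mulrC.
Qed.

Lemma duality_map_intro z (zs : {linear Z -> R[i]^o}) :
  (forall w, rnorm (zs w) <= rnorm z * rnorm w) ->
  zs z = (rnorm z ^+ 2)%:C -> duality_map z zs.
Proof.
move=> zsb zsz; have zsc := dominated_linear_continuous zsb.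
suff dz : dual_norm zs * rnorm z = rnorm z ^+ 2 by split; rewrite ?dz.
have [z0|z0] := eqVneq z 0; first by rewrite z0 rnorm0 mulr0 expr0n.
rewrite expr2; congr (_ * _); apply/eqP; rewrite eq_le.
rewrite dual_norm_le ?rnorm_ge0//=.
have := rnorm_le_dual_norm z zsc.
by rewrite zsz rnorm_real ger0_norm ?sqr_ge0// expr2 ler_pM2r// rnorm_gt0.
Qed.

(** Cancelling [rnorm z] identifies the dual norm with [rnorm z]. At [z = 0] the defining equations
    hold for every continuous functional. *)
Lemma duality_map_elim z (zs : {linear Z -> R[i]^o}) : z != 0 ->
  duality_map z zs ->
  (forall w, rnorm (zs w) <= rnorm z * rnorm w) /\ zs z = (rnorm z ^+ 2)%:C.
Proof.
move=> z0 [zsc zsz dz].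
have dE : dual_norm zs = rnorm z.
  by apply: (mulIf (x := rnorm z)); rewrite ?dz ?expr2// gt_eqF// rnorm_gt0.
by split=> [w|]; [rewrite -dE; exact: rnorm_le_dual_norm|rewrite zsz dz].
Qed.

Lemma duality_map_nonempty z : exists zs, duality_map z zs.
Proof.
have [f [fb fz]] := norming_functional z.
have lin : linear (fun w : Z => (rnorm z)%:C * f w : R[i]^o).
  by move=> k u v; rewrite linearP mulrDr /GRing.scale/= mulrCA.
have [g gE] := linear_of_fun lin.
exists g; apply: duality_map_intro => [w|].
  by rewrite gE rnormM rnorm_real ger0_norm ?rnorm_ge0// ler_wpM2l ?rnorm_ge0.
by rewrite gE fz -rmorphM.
Qed.

Lemma lip_norm_le T (M : R) : 0 <= M ->
  (forall x y, rnorm (T x - T y) <= M * rnorm (x - y)) -> lip_norm T <= M.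
Proof.
move=> M0 TM; rewrite /lip_norm; set E := [set r | _].
have [E0|/nonemptyPn ->] := pselect (E !=set0); last by rewrite sup0.
apply: ge_sup => // _ [x [y [/eqP xy ->]]].
by rewrite ler_pdivrMr ?rnorm_gt0 ?subr_eq0.
Qed.

Lemma lip_norm_ge0 T : 0 <= lip_norm T.
Proof.
rewrite /lip_norm; set E := [set r | _].
(* Without a genuine supremum, [sup] takes its default value 0. *)
have [hs|hs] := pselect (has_sup E); last by rewrite sup_out.
have [r Er] := hs.1; apply: (@le_trans _ _ r); last exact: ub_le_sup hs.2 _ Er.
by have [x [y [_ ->]]] := Er; rewrite divr_ge0 ?rnorm_ge0.
Qed.

Lemma rnorm_le_lip_norm T x y : lipschitz T ->
  rnorm (T x - T y) <= lip_norm T * rnorm (x - y).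
Proof.
move=> /lipschitzP[M M0 TM].
have [->|xy] := eqVneq x y; first by rewrite !subrr !rnorm0 mulr0.
rewrite -ler_pdivrMr ?rnorm_gt0 ?subr_eq0//.
apply: ub_le_sup; last by exists x, y; split=> //; exact/eqP.
exists M => _ [u [v [/eqP uv ->]]].
by rewrite ler_pdivrMr ?rnorm_gt0 ?subr_eq0.
Qed.

Lemma lip_radius_le T (M : R) : 0 <= M ->
  (forall x y zs, x != y -> duality_map (x - y) zs ->
     rnorm (zs (T x - T y)) <= M * rnorm (x - y) ^+ 2) -> lip_radius T <= M.
Proof.
move=> M0 TM; rewrite /lip_radius; set E := [set r | _].
have [E0|/nonemptyPn ->] := pselect (E !=set0); last by rewrite sup0.
apply: ge_sup => // _ [x [y [zs [/eqP xy dzs ->]]]].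
by rewrite ler_pdivrMr ?exprn_gt0 ?rnorm_gt0 ?subr_eq0// TM.
Qed.

Lemma lip_radius_ge0 T : 0 <= lip_radius T.
Proof.
rewrite /lip_radius; set E := [set r | _].
have [hs|hs] := pselect (has_sup E); last by rewrite sup_out.
have [r Er] := hs.1; apply: (@le_trans _ _ r); last exact: ub_le_sup hs.2 _ Er.
by have [x [y [zs [_ _ ->]]]] := Er; rewrite divr_ge0 ?exprn_ge0 ?rnorm_ge0.
Qed.

Lemma rnorm_le_lip_radius T x y zs : lipschitz T -> duality_map (x - y) zs ->
  rnorm (zs (T x - T y)) <= lip_radius T * rnorm (x - y) ^+ 2.
Proof.
move=> lT dzs.
have [xy|xy] := eqVneq x y.
  by rewrite xy !subrr linear0 !rnorm0 expr0n mulr0.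
rewrite -ler_pdivrMr ?exprn_gt0 ?rnorm_gt0 ?subr_eq0//.
apply: ub_le_sup; last by exists x, y, zs; split=> //; exact/eqP.
(* The Lipschitz norm bounds every quotient, so the supremum is genuine. *)
exists (lip_norm T) => _ [u [v [us [/eqP uv dus ->]]]].
have uv0 : u - v != 0 by rewrite subr_eq0.
have [usb _] := duality_map_elim uv0 dus.
rewrite ler_pdivrMr ?exprn_gt0 ?rnorm_gt0//.
rewrite (le_trans (usb _))// expr2 mulrCA ler_wpM2l ?rnorm_ge0//.
exact: rnorm_le_lip_norm.
Qed.

Lemma lip_index_ge0 : 0 <= lip_index Z.
Proof.
rewrite /lip_index; set E := [set _ | _ in _].
have [E0|/nonemptyPn ->] := pselect (E !=set0); last by rewrite inf0.
by apply: lb_le_inf => // _ [T _ <-]; exact: lip_radius_ge0.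
Qed.

Lemma lip_index_le_radius T : Lip0 T -> lip_norm T = 1 -> lip_index Z <= lip_radius T.
Proof.
move=> T0 T1; apply: ge_inf; last by exists T.
by exists 0 => _ [S _ <-]; exact: lip_radius_ge0.
Qed.

(** Homogeneous form of the definition of the index: rescale [T] to Lipschitz norm 1. *)
Lemma lip_index_mul_norm_le T : Lip0 T ->
  lip_index Z * lip_norm T <= lip_radius T.
Proof.
move=> [T0 lT]; have [N0|N0] := eqVneq (lip_norm T) 0.
  by rewrite N0 mulr0 lip_radius_ge0.
have N_gt0 : 0 < lip_norm T by rewrite lt_def N0 lip_norm_ge0.
pose c := (lip_norm T)^-1; have c0 : 0 < c by rewrite invr_gt0.
pose S z := c%:C *: T z.
have SB x y : S x - S y = c%:C *: (T x - T y) by rewrite scalerBr.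
have SN x y : rnorm (S x - S y) = c * rnorm (T x - T y).
  by rewrite SB rnormZr gtr0_norm.
have lS : lipschitz S.
  apply/lipschitzP; exists 1 => // x y.
  by rewrite SN mul1r ler_pdivrMl//; exact: rnorm_le_lip_norm.
have S0 : Lip0 S by split=> //; rewrite /S T0 scaler0.
have S1 : lip_norm S = 1.
  apply/eqP; rewrite eq_le lip_norm_le//=; last first.
    by move=> x y; rewrite SN mul1r ler_pdivrMl//; exact: rnorm_le_lip_norm.
  rewrite -(ler_pM2l N_gt0) mulr1; apply: lip_norm_le => [|x y].
    by rewrite mulr_ge0 ?lip_norm_ge0.
  rewrite -mulrA -ler_pdivrMl// -[leLHS]SN.
  exact: rnorm_le_lip_norm.
rewrite -ler_pdivlMr//; apply: le_trans (lip_index_le_radius S0 S1) _.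
apply: lip_radius_le => [|x y zs xy dzs].
  by rewrite divr_ge0 ?lip_radius_ge0 ?lip_norm_ge0.
rewrite SB linearZ/= [leLHS]rnormZr gtr0_norm// mulrAC [leRHS]mulrC.
by rewrite ler_wpM2l ?(ltW c0)//; exact: rnorm_le_lip_radius.
Qed.

Lemma lip_norm_id : (exists z : Z, z != 0) -> lip_norm (@id Z) = 1.
Proof.
move=> [z z0]; apply/eqP; rewrite eq_le lip_norm_le => [|//|x y]; last by rewrite mul1r.
have lid : lipschitz (@id Z) by apply/lipschitzP; exists 1 => // x y; rewrite mul1r.
have := rnorm_le_lip_norm z 0 lid.
by rewrite subr0 -ler_pdivrMr ?rnorm_gt0// divff// gt_eqF// rnorm_gt0.
Qed.

Lemma Lip0_id : Lip0 (@id Z).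
Proof. by split=> //; apply/lipschitzP; exists 1 => // x y; rewrite mul1r. Qed.

(** A nonzero vector gives the identity norm 1, so the infimum is over a nonempty set and not the
    default 0. *)
Lemma le_lip_index (m : R) : (exists z : Z, z != 0) ->
  (forall T, Lip0 T -> lip_norm T = 1 -> m <= lip_radius T) -> m <= lip_index Z.
Proof.
move=> z0 h; apply: lb_le_inf; last by move=> _ [T [T0 T1] <-]; exact: h.
by apply: image_nonempty; exists id; split; [exact: Lip0_id|exact: lip_norm_id].
Qed.

Lemma lip_index_trivial : (forall z : Z, z = 0) -> lip_index Z = 0.
Proof.
move=> z0; rewrite /lip_index.
suff -> : [set T : Z -> Z | Lip0 T /\ lip_norm T = 1] = set0.
  by rewrite image_set0 inf0.
apply/seteqP; split=> // T [_]; suff -> : lip_norm T = 0.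
  by move/eqP; rewrite eq_sym oner_eq0.
apply/eqP; rewrite eq_le lip_norm_ge0 andbT; apply: lip_norm_le => // x y.
by rewrite (z0 (T x)) (z0 (T y)) subrr rnorm0 mul0r.
Qed.

End lipschitz_maps.

(** * Superposition operators *)
Lemma ler_of_small_perturb {R : realType} (x y d K : R) : 0 < d -> 0 <= K ->
  (forall a, 0 < a <= d -> x <= y + a * K) -> x <= y.
Proof.
move=> d0 K0 h; rewrite leNgt; apply/negP => yx.
pose a := Num.min d ((x - y) / (K + 1)).
have K1 : 0 < K + 1 by lra.
have a0 : 0 < a by rewrite lt_min d0 divr_gt0// subr_gt0.
have ad : a <= d by rewrite ge_min lexx.
have aK : a * (K + 1) <= x - y by rewrite -ler_pdivlMr// ge_min lexx orbT.
have := h a; rewrite a0 ad => /(_ isT); lra.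
Qed.

(* Apply a duality functional of [h' := (x - y) + a *: (T x - T y)] to
   [h' - a *: (T (y + h') - T y)], which is within [|a|^2 L^2 |x - y|] of
   [x - y]. *)
Lemma lip_radius_shift_le {R : realType} {Z : normedModType R[i]} (T : Z -> Z)
    (a : R[i]) (x y : Z) : lipschitz T ->
  (1 - rnorm (a : R[i]^o) * lip_radius T) * rnorm (x - y + a *: (T x - T y)) <=
  (1 + (rnorm (a : R[i]^o) * lip_norm T) ^+ 2) * rnorm (x - y).
Proof.
move=> lT; set h' := x - y + _.
have [h'0|h'0] := eqVneq h' 0.
  by rewrite h'0 rnorm0 mulr0 mulr_ge0 ?rnorm_ge0// addr_ge0// sqr_ge0.
have [zs dzs] := duality_map_nonempty h'.
have [zsb zsh] := duality_map_elim h'0 dzs.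
have h'E : h' = (y + h') - y by rewrite addrAC subrr add0r.
have radius : rnorm (zs (T (y + h') - T y)) <= lip_radius T * rnorm h' ^+ 2.
  by rewrite [in leRHS]h'E; apply: rnorm_le_lip_radius; rewrite // -h'E.
pose k := h' - a *: (T (y + h') - T y).
have k_low : rnorm h' ^+ 2 - rnorm (a : R[i]^o) * (lip_radius T * rnorm h' ^+ 2)
    <= rnorm h' * rnorm k.
  pose v : R[i]^o := a *: zs (T (y + h') - T y).
  have zk : zs k + v = (rnorm h' ^+ 2)%:C by rewrite linearB zsh [zs (a *: _)]linearZ subrK.
  have := rnormD (zs k) v; rewrite zk rnorm_real ger0_norm ?sqr_ge0// /v rnormZ.
  have := ler_wpM2l (rnorm_ge0 (a : R[i]^o)) radius; have := zsb k; lra.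
have k_up : rnorm k <= (1 + (rnorm (a : R[i]^o) * lip_norm T) ^+ 2) * rnorm (x - y).
  have -> : k = (x - y) + a *: (T x - T (y + h')).
    rewrite /k /h' -addrA -scalerBr; congr (_ + _ *: _).
    by rewrite opprB addrA subrK.
  have d1 : rnorm (T x - T (y + h')) <=
      lip_norm T * (rnorm (a : R[i]^o) * (lip_norm T * rnorm (x - y))).
    rewrite (le_trans (rnorm_le_lip_norm _ _ lT))// ler_wpM2l ?lip_norm_ge0//.
    have -> : x - (y + h') = - (a *: (T x - T y)).
      by rewrite /h' opprD addrA opprD addrA subrr sub0r.
    by rewrite rnormN rnormZ ler_wpM2l ?rnorm_ge0//; exact: rnorm_le_lip_norm.
  have := rnormD (x - y) (a *: (T x - T (y + h'))); rewrite rnormZ.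
  have := ler_wpM2l (rnorm_ge0 (a : R[i]^o)) d1; lra.
rewrite (le_trans _ k_up)// -(ler_pM2l (x := rnorm h')) ?rnorm_gt0//.
apply: (le_trans _ k_low); rewrite expr2; lra.
Qed.

(** Multiplied by [a], the difference of the two sides of the conclusion is exactly that of the
    hypothesis. *)
Lemma lumer_arith {R : realType} (a nu L s h : R) : 0 < a ->
  (1 - a * nu) * (h * h + a * s) <= h * ((1 + (a * L) ^+ 2) * h) ->
  s <= nu * h ^+ 2 + a * (nu * s + L ^+ 2 * h ^+ 2).
Proof.
move=> a0 main; rewrite -subr_ge0 -(pmulr_rge0 _ a0).
set lhs := (X in 0 <= X); suff -> : lhs =
  h * ((1 + (a * L) ^+ 2) * h) - (1 - a * nu) * (h * h + a * s) by rewrite subr_ge0.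
by rewrite /lhs; ring.
Qed.

Lemma lumer_step_bound {R : realType} (a nu : R) : 0 <= nu ->
  0 < a <= (2 * (nu + 1))^-1 -> 0 < 1 - a * nu.
Proof.
move=> nu0 /andP[a0 ad].
have : a * (2 * (nu + 1)) <= 1 by rewrite -ler_pdivlMr ?div1r//; lra.
have := mulr_ge0 (ltW a0) nu0; lra.
Qed.

(** * Pointwise evaluation in the function space, and composition with a Lipschitz map *)

Section function_space.
Context {R : realType} {Omega : topologicalType} {X : normedModType R[i]}.
Context {A : closed_subspace (Cb Omega X)}.
Implicit Types (f g : cs_type A) (t : Omega).

Definition ev f t : X := cs_val f t.

Lemma evD f g t : ev (f + g) t = ev f t + ev g t. Proof. by []. Qed.
Lemma evB f g t : ev (f - g) t = ev f t - ev g t. Proof. by []. Qed.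
Lemma evZ (c : R[i]) f t : ev (c *: f) t = c *: ev f t. Proof. by []. Qed.
Lemma ev0 t : ev (0 : cs_type A) t = 0. Proof. by []. Qed.

Lemma ev_inj f g : (forall t, ev f t = ev g t) -> f = g.
Proof. by move=> fg; do 2 apply: val_inj; exact/funext. Qed.

Lemma rnorm_ev_le f t : rnorm (ev f t) <= rnorm f.
Proof. exact: rnorm_le_sup_norm. Qed.

Lemma rnorm_cs_le f (M : R) : 0 <= M ->
  (forall t, rnorm (ev f t) <= M) -> rnorm f <= M.
Proof. exact: sup_norm_le. Qed.

Lemma functions_of_ev (u : Omega -> X) :
  functions_of A u -> exists f, forall t, ev f t = u t.
Proof. by move=> [f Af <-]; exists (MkCs (mem_set Af)). Qed.

Lemma ev_in f : cs_set A (cs_val f).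
Proof. by apply: set_mem; exact: cs_valP. Qed.

Section superposition.
Context {S : X -> X} {T : cs_type A -> cs_type A}.
Hypothesis TE : forall f t, ev (T f) t = S (ev f t).
Hypothesis S_lip : lipschitz S.

Lemma superposition_dist_le f g : rnorm (T f - T g) <= lip_norm S * rnorm (f - g).
Proof.
apply: rnorm_cs_le => [|t]; first by rewrite mulr_ge0 ?lip_norm_ge0 ?rnorm_ge0.
rewrite evB !TE (le_trans (rnorm_le_lip_norm _ _ S_lip))//.
by rewrite ler_wpM2l ?lip_norm_ge0// -evB rnorm_ev_le.
Qed.

Lemma superposition_lipschitz : lipschitz T.
Proof.
apply/lipschitzP; exists (lip_norm S); first exact: lip_norm_ge0.
exact: superposition_dist_le.
Qed.

(** A duality functional of [f - g] is applied to [f - g + b *: (T f - T g)], whose norm is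
    controlled by the shift estimate for [S] at each point. Expanding and letting [|b| = a] tend to
    0 isolates the numerical radius. *)
Lemma superposition_radius_le : lip_radius T <= lip_radius S.
Proof.
apply: lip_radius_le => [|f g zs fg dzs]; first exact: lip_radius_ge0.
have h0 : f - g != 0 by rewrite subr_eq0.
have [zsb zsh] := duality_map_elim h0 dzs.
set s := rnorm (zs _); set nh := rnorm (f - g); set nu := lip_radius S.
have nu0 : 0 <= nu := lip_radius_ge0 S.
have nh0 : 0 <= nh := rnorm_ge0 _.
have s0 : 0 <= s := rnorm_ge0 _.
have [c c1 cz] := rnorm_phase (zs (T f - T g)).
have d0 : 0 < (2 * (nu + 1))^-1 by rewrite invr_gt0 mulr_gt0// ltr_pwDr.
pose K := nu * s + lip_norm S ^+ 2 * nh ^+ 2.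
have K0 : 0 <= K by apply: addr_ge0; apply: mulr_ge0 => //; exact: sqr_ge0.
apply: (@ler_of_small_perturb R s (nu * nh ^+ 2) _ K d0 K0).
move=> a aa; have anu := lumer_step_bound nu0 aa; have /andP[a0 _] := aa.
(* The phase [c] makes [b * zs (T f - T g)] equal to the nonnegative real [a * s], so nothing
   cancels against [zs (f - g)]. *)
pose b : R[i] := a%:C * c.
have bE : rnorm (b : R[i]^o) = a by rewrite rnormM c1 mulr1 rnorm_real gtr0_norm.
pose M := (1 - a * nu)^-1 * ((1 + (a * lip_norm S) ^+ 2) * nh).
have M0 : 0 <= M.
  apply: mulr_ge0; first by rewrite invr_ge0 ltW.
  by apply: mulr_ge0 => //; apply: addr_ge0 => //; exact: sqr_ge0.
have shift : rnorm (f - g + b *: (T f - T g)) <= M.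
  apply: rnorm_cs_le => // t.
  rewrite evD evZ !evB !TE ler_pdivlMl//.
  have := lip_radius_shift_le b (ev f t) (ev g t) S_lip.
  rewrite bE => /le_trans; apply.
  apply: ler_wpM2l; first by apply: addr_ge0 => //; exact: sqr_ge0.
  by rewrite -evB; exact: rnorm_ev_le.
have := zsb (f - g + b *: (T f - T g)).
rewrite linearD linearZ/= zsh.
have -> : b *: zs (T f - T g) = (a * s)%:C.
  by rewrite /b /GRing.scale/= -mulrA cz -rmorphM.
rewrite -rmorphD/= rnorm_real ger0_norm ?addr_ge0 ?sqr_ge0 ?mulr_ge0 ?(ltW a0)//.
move=> /le_trans/(_ (ler_wpM2l nh0 shift)).
rewrite /M mulrCA ler_pdivlMl// => {}main.
by apply: lumer_arith => //; rewrite -expr2.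
Qed.

Hypothesis constants : forall x : X, exists f, forall t, ev f t = x.
Hypothesis Omega_ne : [set: Omega] !=set0.

(** On constant functions [T] acts as [S], and distances between constants are those of their
    values. *)
Lemma superposition_norm : lip_norm T = lip_norm S.
Proof.
apply/eqP; rewrite eq_le lip_norm_le ?lip_norm_ge0//=; last exact: superposition_dist_le.
apply: lip_norm_le => [|x y]; first exact: lip_norm_ge0.
have [t _] := Omega_ne.
have [f fx] := constants x; have [g gy] := constants y.
have := rnorm_le_lip_norm f g superposition_lipschitz.
have -> : rnorm (f - g) = rnorm (x - y).
  apply/eqP; rewrite eq_le; apply/andP; split.
    by apply: rnorm_cs_le => [|u]; rewrite ?rnorm_ge0// evB fx gy.
  by rewrite -(fx t) -(gy t) -evB rnorm_ev_le.
apply: le_trans; have := rnorm_ev_le (T f - T g) t.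
by rewrite evB !TE fx gy.
Qed.

End superposition.
End function_space.

(** * Peak functions with values in a Stolz region *)
Section square_root_estimates.
Context {R : realType}.
Implicit Types (a b d p q r x y : R).

(** For a root [p + i q] of modulus [r], a cone of parameter [d] containing the square narrows to
    [d / 2]: [2 p^2 = r^2 + (p^2 - q^2) >= (2 - d) r^2]. *)
Lemma sqrt_cone p q r d : 0 <= d <= 1 -> 0 <= p -> 0 <= r ->
  r ^+ 2 = p ^+ 2 + q ^+ 2 -> (1 - d) * r ^+ 2 <= p ^+ 2 - q ^+ 2 ->
  (1 - d / 2) * r <= p.
Proof.
move=> /andP[d0 d1] p0 r0 rE h.
have c0 : 0 <= 1 - d / 2 by lra.
rewrite -(ler_pXn2r (ltn0Sn 1)) ?nnegrE ?mulr_ge0// exprMn.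
have : (1 - d / 2) ^+ 2 * r ^+ 2 <= (1 - d / 2) * r ^+ 2.
  rewrite ler_wpM2r ?sqr_ge0// expr2 ler_piMr//; lra.
move/le_trans; apply; lra.
Qed.

Lemma sqrt_le_half r d : 0 <= d -> 0 <= r -> r ^+ 2 <= 1 + d -> r <= 1 + d / 2.
Proof.
move=> d0 r0 h; rewrite -(ler_pXn2r (ltn0Sn 1)) ?nnegrE//; last by lra.
apply: le_trans h _; have := sqr_ge0 (d / 2); lra.
Qed.

Lemma sqrt_ge_self r b : 0 <= b <= 1 -> 0 <= r -> b <= r ^+ 2 -> b <= r.
Proof.
move=> /andP[b0 b1] r0 h; rewrite -(ler_pXn2r (ltn0Sn 1)) ?nnegrE//.
by apply: le_trans h; rewrite expr2 ler_piMr.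
Qed.

(** From [1 - r^2 = (1 - r) (1 + r)] with [1 + r >= 1 + b], the gap to 1 shrinks by the factor
    [(1 + b)^-1]. *)
Lemma sqrt_ge_one_sub r b d : 0 <= b -> 0 <= d -> b <= r -> 1 - d <= r ^+ 2 ->
  1 - (1 + b)^-1 * d <= r.
Proof.
move=> b0 d0 br h; have b1 : 0 < 1 + b by lra.
have [r1|r1] := leP 1 r.
  by rewrite (le_trans _ r1)// gerBl mulr_ge0// invr_ge0 ltW.
rewrite lerBlDl -lerBlDr ler_pdivlMl// .
have : (1 + b) * (1 - r) <= (1 + r) * (1 - r) by rewrite ler_wpM2r//; lra.
by move/le_trans; apply; lra.
Qed.

(* With [m = |v|], [x = Re v] and [l = |1 - v|]: a narrow cone with vertex [0]
   is carried by [v |-> 1 - v] into a Stolz region at [1]. *)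
Lemma stolz_of_cone m x l e d : 0 < e <= 1 -> 0 <= d -> d <= e ^+ 2 / 4 ->
  0 <= m <= 1 + d -> (1 - d) * m <= x -> 0 <= l ->
  l ^+ 2 = 1 - 2 * x + m ^+ 2 -> l + (1 - e) * m <= 1.
Proof.
move=> /andP[e0 e1] d0 de /andP[m0 m1] xm l0 lE.
have ee : e ^+ 2 <= e by rewrite expr2 ler_piMr// ltW.
have em : (1 - e) * m <= 1.
  have : (1 - e) * m <= (1 - e) * (1 + d) by rewrite ler_wpM2l//; lra.
  by have := mulr_ge0 (ltW e0) d0; lra.
rewrite -lerBrDr -(ler_pXn2r (ltn0Sn 1)) ?nnegrE ?subr_ge0// lE.
have : 0 <= m * (2 * e - 2 * d - m * (2 * e - e ^+ 2)).
  rewrite mulr_ge0//.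
  have : m * (2 * e - e ^+ 2) <= (1 + d) * (2 * e - e ^+ 2).
    by rewrite ler_wpM2r//; lra.
  have := ler_wpM2l (ltW e0) de; have := mulr_ge0 d0 (sqr_ge0 e).
  have : e * (e ^+ 2 / 4) <= e ^+ 2 / 4 by rewrite ler_piMl// divr_ge0 ?sqr_ge0.
  lra.
lra.
Qed.

(** In a narrow cone near the unit circle, [v] is close to 1: [l^2 = (1 - m)^2 + 2 (m - x) <= d^2 +
    2 d m <= 5 d]. *)
Lemma small_of_cone m x l e d : 0 < e <= 1 -> 0 <= d -> d <= e ^+ 2 / 8 ->
  1 - d <= m <= 1 + d -> (1 - d) * m <= x -> 0 <= l ->
  l ^+ 2 = 1 - 2 * x + m ^+ 2 -> l <= e.
Proof.
move=> /andP[e0 e1] d0 de /andP[m0 m1] xm l0 lE.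
have ee : e ^+ 2 <= e by rewrite expr2 ler_piMr// ltW.
rewrite -(ler_pXn2r (ltn0Sn 1)) ?nnegrE ?(ltW e0)// lE.
have dd : d ^+ 2 <= d by rewrite expr2 ler_piMr//; lra.
have : (1 - m) ^+ 2 <= d ^+ 2.
  by rewrite -real_normK ?num_real// ler_pXn2r ?nnegrE// ler_norml; lra.
have : d * m <= d * (1 + d) by rewrite ler_wpM2l.
lra.
Qed.

End square_root_estimates.

(** * Principal complex square roots *)

Section complex_square_root.
Context {R : realType}.
Implicit Types s v z : R[i].

Lemma rnorm_sqr s : rnorm (s ^+ 2 : R[i]^o) = complex.Re s ^+ 2 + complex.Im s ^+ 2.
Proof. by rewrite rnormX sqr_rnorm. Qed.

Lemma Re_sqr s : complex.Re (s ^+ 2) = complex.Re s ^+ 2 - complex.Im s ^+ 2.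
Proof. by case: s => p q; rewrite expr2 /= -!expr2. Qed.

Lemma sqr_rnorm_one_sub v :
  rnorm (1 - v : R[i]^o) ^+ 2 = 1 - 2 * complex.Re v + rnorm (v : R[i]^o) ^+ 2.
Proof. by rewrite !sqr_rnorm; case: v => p q /=; ring. Qed.

Lemma Re_sqrtc_ge0 v : 0 <= complex.Re (sqrtc v).
Proof. by case: v => a b; rewrite /sqrtc /= sqrtr_ge0. Qed.

(** With [s = p + i q], the hypothesis reads [(p^2 + q^2)^2 <= 2 (p^2 - q^2) <= 4 p^2], hence
    [p^2 + q^2 <= 2 p]. *)
Lemma one_sub_sqrt_disc s : 0 <= complex.Re s ->
  rnorm (1 - s ^+ 2 : R[i]^o) <= 1 -> rnorm (1 - s : R[i]^o) <= 1.
Proof.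
move=> p0 h.
have : rnorm (1 - s ^+ 2 : R[i]^o) ^+ 2 <= 1 by rewrite expr_le1// rnorm_ge0.
rewrite sqr_rnorm_one_sub rnorm_sqr Re_sqr => {}h.
rewrite -(ler_pXn2r (ltn0Sn 1)) ?nnegrE ?rnorm_ge0// expr1n sqr_rnorm_one_sub sqr_rnorm.
set p := complex.Re s in p0 h *; set q := complex.Im s in h *.
suff : p ^+ 2 + q ^+ 2 <= 2 * p by lra.
rewrite -(ler_pXn2r (ltn0Sn 1)) ?nnegrE ?addr_ge0 ?sqr_ge0 ?mulr_ge0//.
have := sqr_ge0 q; have := sqr_ge0 p; rewrite exprMn; lra.
Qed.

End complex_square_root.

(** * Uniform limits, closedness and the decay of the approximation error *)

Lemma uniform_approx_continuous {R : realType} {Omega : topologicalType}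
    {V : normedModType R[i]} (w : Omega -> V) :
  (forall e : R, 0 < e -> exists2 u : Omega -> V, continuous u &
     forall t, rnorm (w t - u t) <= e) -> continuous w.
Proof.
move=> h t; apply/cvgrPdist_lt => e e0.
have eR : (complex.Re e)%:C = e by rewrite RRe_real// gtr0_real.
have r0 : 0 < complex.Re e by rewrite -ltcR eR.
set r := complex.Re e in eR r0.
have r4 : 0 < r / 4 by rewrite divr_gt0.
have [u cu wu] := h _ r4.
have r4C : 0 < (r / 4)%:C by rewrite ltcR.
have := cu t => /cvgrPdist_lt/(_ _ r4C); apply: filterS => s.
rewrite -!rnormE -eR !ltcR => us.
have -> : w t - w s = (w t - u t) + ((u t - u s) - (w s - u s)).
  by rewrite opprB addrA subrKA addrA subrK.
have := rnormD (w t - u t) ((u t - u s) - (w s - u s)).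
have := rnormB_le (u t - u s) (w s - u s).
have := wu t; have := wu s; move: us.
set x1 := rnorm _; set x2 := rnorm _; set x3 := rnorm _; set x4 := rnorm _.
set x5 := rnorm _; clearbody x1 x2 x3 x4 x5; clear -r0; lra.
Qed.

Lemma closed_rnorm_approx {R : realType} {V : normedModType R[i]} (B : set V) (w : V) :
  closed B -> (forall e : R, 0 < e -> exists2 u, B u & rnorm (w - u) <= e) -> B w.
Proof.
move=> cB h; apply: cB => N /nbhs_ballP[e /= e0 eN].
have eR : (complex.Re e)%:C = e by rewrite RRe_real// gtr0_real.
have r0 : 0 < complex.Re e by rewrite -ltcR eR.
have r2 : 0 < complex.Re e / 2 by rewrite divr_gt0.
have [u Bu wu] := h _ r2.
exists u; split=> //; apply: eN; rewrite -ball_normE /= -eR -rnormE ltcR.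
by apply: le_lt_trans wu _; rewrite ltr_pdivrMr//; lra.
Qed.

(** The map [e |-> e - e^2 / 2] is increasing on [[0, 1]], so it suffices to evaluate it at the
    bound. The offset makes the initial error 1 at [n = 0]. *)
Lemma half_square_decay {R : realType} (e : R) n : 0 <= e <= 2 / n.+2%:R ->
  0 <= e - e ^+ 2 / 2 <= 2 / n.+3%:R.
Proof.
move=> /andP[e0 eb]; set b := 2 / n.+2%:R in eb.
have b1 : b <= 1 by rewrite ler_pdivrMr// mul1r ler_nat.
have : e ^+ 2 <= e by rewrite expr2 ler_piMr//; lra.
have : 0 <= (b - e) * (1 - (b + e) / 2) by rewrite mulr_ge0//; lra.
have : b - b ^+ 2 / 2 <= 2 / n.+3%:R.
  rewrite ler_pdivlMr// -[n.+3]addn1 natrD.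
  have bn : b * n.+2%:R = 2 by rewrite divfK.
  have -> : (b - b ^+ 2 / 2) * (n.+2%:R + 1) =
    b * n.+2%:R + b - b * (b * n.+2%:R) / 2 - b ^+ 2 / 2 by ring.
  by rewrite bn; have := sqr_ge0 b; lra.
set c := 2 / n.+3%:R; clearbody b c => h1 h2 h3.
by apply/andP; split; lra.
Qed.

(** * Square roots and peak functions in a function algebra *)

Section function_algebra_theory.
Context {R : realType} {Omega : topologicalType}.
Local Notation CbC := (Cb Omega R[i]^o).
Context {B : set CbC}.
Hypothesis algB : function_algebra B.
Implicit Types (f g : CbC) (t : Omega).

Lemma algebraD f g : B f -> B g -> B (f + g).
Proof.
case: algB => -[[_ sB] _] _ _ _ Bf Bg.
have := sB 1 f g; rewrite /= scale1r => h; apply: set_mem; apply: h; exact: mem_set.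
Qed.

Lemma algebraZ (c : R[i]) f : B f -> B (c *: f).
Proof.
case: algB => -[[B0 sB] _] _ _ _ Bf.
rewrite -[_ *: _]addr0; apply: set_mem; apply: sB; [exact: mem_set|exact: B0].
Qed.

Lemma algebraM f g : B f -> B g -> exists2 h, B h & forall t, h t = f t * g t.
Proof.
by case: algB => _ sB _ _ Bf Bg; have [h Bh hE] := sB f g Bf Bg; exists h => // t; rewrite hE.
Qed.

Lemma algebra_cst (c : R[i]) : exists2 h, B h & forall t, h t = c.
Proof. by case: algB => _ _ _ sB; have [h Bh hE] := sB c; exists h => // t; rewrite hE. Qed.

(* [u' := (y + u^2) / 2] contracts towards the solution [w] of
   [w = (y + w^2) / 2], i.e. of [(1 - w)^2 = 1 - y]. *)
Lemma algebra_sqrt_approx f (w : Omega -> R[i]^o) n : B f ->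
  (forall t, rnorm (f t) <= 1) -> (forall t, rnorm (w t) <= 1) ->
  (forall t, (1 - w t) ^+ 2 = 1 - f t) ->
  exists u (e : R), [/\ B u, 0 <= e <= 2 / n.+2%:R, forall t, rnorm (u t) <= 1 - e &
    forall t, rnorm (w t - u t) <= e].
Proof.
move=> Bf f1 w1 wE; elim: n => [|n [u [e [Bu /andP[e0 en] ue wu]]]].
  have [u Bu uE] := algebra_cst 0; exists u, 1; split=> //.
  - by rewrite ler01 divff// lexx.
  - by move=> t; rewrite uE rnorm0 subrr.
  - by move=> t; rewrite uE subr0.
have [u2 Bu2 u2E] := algebraM Bu Bu.
exists ((2^-1)%:C *: (f + u2)), (e - e ^+ 2 / 2); split.
- by apply/algebraZ/algebraD.
- by apply: half_square_decay; rewrite e0 en.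
- move=> t; have -> : ((2^-1)%:C *: (f + u2)) t = (2^-1)%:C *: (f t + u2 t) by [].
  rewrite rnormZr ger0_norm ?invr_ge0// ler_pdivrMl//.
  rewrite (le_trans (rnormD _ _))// u2E rnormM.
  have : rnorm (u t) * rnorm (u t) <= (1 - e) * (1 - e).
    by rewrite ler_pM ?rnorm_ge0.
  by have := f1 t; set x1 := rnorm (f t); set x2 := _ * _; lra.
- move=> t; have -> : ((2^-1)%:C *: (f + u2)) t = (2^-1)%:C *: (f t + u2 t) by [].
  have -> : w t - (2^-1)%:C *: (f t + u2 t) = (2^-1)%:C *: ((w t - u t) * (w t + u t) : R[i]^o).
    have -> : f t = 1 - (1 - w t) ^+ 2 by rewrite wE subKr.
    have two : (2^-1)%:C * 2 = 1 :> R[i] by rewrite fmorphV rmorph_nat mulVf.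
    rewrite u2E /GRing.scale/=; set c := (2^-1)%:C in two *.
    by rewrite -[X in X - _ = _]mul1r -{1}two; ring.
  rewrite rnormZr ger0_norm ?invr_ge0// ler_pdivrMl// rnormM.
  have wu2 : rnorm (w t + u t) <= 2 - e.
    by have := rnormD (w t) (u t); have := w1 t; have := ue t; lra.
  have : rnorm (w t - u t) * rnorm (w t + u t) <= e * (2 - e).
    by rewrite ler_pM ?rnorm_ge0.
  by move/le_trans; apply; lra.
Qed.

(** The function [1 - sqrtc (1 - f)] is a uniform limit of elements of the closed algebra; the
    principal root has nonnegative real part, which keeps it in the unit disc. *)
Lemma algebra_sqrt f : B f -> (forall t, rnorm (f t) <= 1) ->
  exists g, [/\ B g, forall t, rnorm (g t) <= 1 &
    forall t, 1 - g t = sqrtc (1 - f t)].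
Proof.
move=> Bf f1; pose w t : R[i]^o := 1 - sqrtc (1 - f t).
have wE t : (1 - w t) ^+ 2 = 1 - f t by rewrite subKr sqr_sqrtc.
have w1 t : rnorm (w t) <= 1.
  apply: one_sub_sqrt_disc; first exact: Re_sqrtc_ge0.
  by rewrite sqr_sqrtc subKr.
have approx (e : R) : 0 < e -> exists2 u, B u & forall t, rnorm (w t - u t) <= e.
  move=> e0; pose n := Num.bound (2 / e).
  have [u [d [Bu /andP[_ dn] _ wu]]] := algebra_sqrt_approx n Bf f1 w1 wE.
  exists u => // t; apply: le_trans (wu t) (le_trans dn _).
  rewrite ler_pdivrMr// mulrC -ler_pdivrMr//.
  have e2 : 0 <= 2 / e by rewrite divr_ge0// ltW.
  have := archi_boundP e2.
  by move/ltW/le_trans; apply; rewrite ler_nat -/n -addn2 leq_addr.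
have cw : continuous w.
  apply: uniform_approx_continuous => e e0; have [u _ wu] := approx e e0.
  by exists u => //; have := Cb_funP u; rewrite inE => -[].
have bw : w \in @bcts R Omega R[i]^o.
  by rewrite inE; split=> //; apply/bounded_funE; exists 1.
exists (MkCb bw); split=> [|//|t]; last by rewrite /= subKr.
have cB : closed B by case: algB => -[].
apply: (closed_rnorm_approx cB) => e e0; have [u Bu wu] := approx e e0.
exists u => //; apply: sup_norm_le; first exact: ltW.
exact: wu.
Qed.

(** Each root of [1 - g] narrows its cone and pushes its modulus towards 1. The common rate [d]
    covers the factor [1 / 2] for the cone and upper bound, and [(1 + b)^-1] for the lower bound off
    [U]. At [n = 0] the bounds only say [Re (1 - f) >= 0] and [|1 - f| <= 2]. *)
Lemma peak_sqrt_iter f t0 (U : set Omega) (b d : R) n : B f ->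
  (forall t, rnorm (f t) <= 1) -> f t0 = 1 -> 0 < b <= 1 ->
  (forall t, ~ U t -> b <= rnorm (1 - f t)) ->
  1 / 2 <= d -> (1 + b)^-1 <= d -> d <= 1 ->
  exists g, [/\ B g, forall t, rnorm (g t) <= 1, g t0 = 1,
    forall t, (1 - d ^+ n) * rnorm (1 - g t) <= complex.Re (1 - g t) /\
              rnorm (1 - g t) <= 1 + d ^+ n &
    forall t, ~ U t -> b <= rnorm (1 - g t) /\ 1 - d ^+ n <= rnorm (1 - g t)].
Proof.
move=> Bf f1 ft0 /andP[b0 b1] fU d_half db d1.
have d0 : 0 <= d by lra.
elim: n => [|n [g [Bg g1 gt0 gcone gU]]].
  exists f; split=> // t; rewrite expr0 subrr.
    split; last first.
      have := rnormB_le (1 : R[i]^o) (f t); rewrite rnorm1.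
      by move/le_trans; apply; rewrite lerD2l.
    have := le_trans (Re_le_rnorm (f t)) (f1 t).
    rewrite mul0r ler_norml => /andP[_]; rewrite -subr_ge0.
    by case: (f t) => p q.
  by move=> Ut; rewrite fU// rnorm_ge0.
have dn0 : 0 <= d ^+ n by rewrite exprn_ge0.
have dn1 : d ^+ n <= 1 by rewrite exprn_ile1.
have half_le : d ^+ n / 2 <= d ^+ n.+1 by rewrite exprS mulrC ler_wpM2r//; lra.
have [h [Bh h1 hE]] := algebra_sqrt Bg g1.
have sq t : (1 - h t) ^+ 2 = 1 - g t by rewrite hE sqr_sqrtc.
have rE t : rnorm (1 - h t) ^+ 2 = rnorm (1 - g t) by rewrite -rnormX sq.
exists h; split=> // [|t|t Ut].
- by have := hE t0; rewrite gt0 subrr sqrtc0 => /eqP; rewrite subr_eq0 => /eqP.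
- have [c1 c2] := gcone t; split.
    apply: (le_trans (y := (1 - d ^+ n / 2) * rnorm (1 - h t))).
      by rewrite ler_wpM2r ?rnorm_ge0//; lra.
    apply: (@sqrt_cone _ _ (complex.Im (1 - h t))); rewrite ?dn0 ?rnorm_ge0//.
    + by rewrite hE Re_sqrtc_ge0.
    + exact: sqr_rnorm.
    + by rewrite -Re_sqr sq rE.
  apply: (le_trans (y := 1 + d ^+ n / 2)); last by lra.
  by apply: sqrt_le_half; rewrite ?rnorm_ge0// rE.
- have [c1 c2] := gU t Ut.
  have br : b <= rnorm (1 - h t).
    by apply: sqrt_ge_self; rewrite ?rnorm_ge0 ?rE ?(ltW b0).
  split=> //; apply: (le_trans (y := 1 - (1 + b)^-1 * d ^+ n)).
    by rewrite exprS lerD2l lerN2 ler_wpM2r.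
  by apply: sqrt_ge_one_sub; rewrite ?rE ?(ltW b0).
Qed.

(** Normalise a peak function to value 1 at [t0] and take roots until [d ^+ n <= e ^+ 2 / 8]; the
    cone estimates with [v = 1 - g] then give both conclusions. *)
Lemma strong_peak_function t0 (U : set Omega) (e : R) :
  strong_peak_point B t0 -> open U -> U t0 -> 0 < e <= 1 ->
  exists g, [/\ B g, g t0 = 1,
    forall t, rnorm (g t) + (1 - e) * rnorm (1 - g t) <= 1 &
    forall t, ~ U t -> rnorm (g t) <= e].
Proof.
move=> [f [Bf ft0 fpeak]] oU Ut0 e01; have /andP[e0 e1] := e01.
have f_gt0 : 0 < rnorm f.
  (* Over the empty complement of [setT] the supremum is 0, so the peak function is nonzero. *)
  have := fpeak setT openT I; set E := [set _ | _ in _].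
  suff -> : E = set0 by rewrite sup0.
  by rewrite /E setCT image_set0.
pose s := sup [set rnorm (f t) | t in ~` U].
have s_lt : s < rnorm f := fpeak U oU Ut0.
have fs t : ~ U t -> rnorm (f t) <= s.
  move=> nUt; apply: ub_le_sup; last by exists t.
  by exists (rnorm f) => _ [v _ <-]; exact: rnorm_le_sup_norm.
have s0 : 0 <= s.
  have [[t Ut]|/nonemptyPn U0] := pselect ((~` U) !=set0).
    exact: le_trans (rnorm_ge0 _) (fs t Ut).
  by rewrite /s U0 image_set0 sup0.
have c0 : f t0 != 0 by rewrite -rnorm_gt0 ft0.
pose y := (f t0)^-1 *: f.
have yn t : rnorm (y t) = rnorm (f t) / rnorm f.
  rewrite -ft0; apply: (mulIf (x := rnorm (f t0))); first by rewrite ft0 gt_eqF.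
  rewrite divfK ?ft0 ?gt_eqF// -ft0 -rnormM; congr rnorm.
  by rewrite mulrC mulrA divff// mul1r.
pose b := 1 - s / rnorm f.
have b01 : 0 < b <= 1.
  by rewrite subr_gt0 ltr_pdivrMr// mul1r s_lt/= gerBl divr_ge0// ltW.
have /andP[b0 b1] := b01.
have yb t : ~ U t -> b <= rnorm (1 - y t).
  move=> Ut; have := rnormD (1 - y t) (y t); rewrite subrK rnorm1 yn.
  have : rnorm (f t) / rnorm f <= s / rnorm f by rewrite ler_pM2r ?invr_gt0// fs.
  by rewrite /b; lra.
pose d := Num.max (1 / 2) (1 + b)^-1.
have dhalf : 1 / 2 <= d by rewrite le_max lexx.
have db : (1 + b)^-1 <= d by rewrite le_max lexx orbT.
have d1 : d < 1.
  have b1_gt1 : 1 < 1 + b by rewrite ltrDl.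
  by rewrite gt_max invf_lt1 ?b1_gt1 ?andbT ?(lt_trans ltr01)//; lra.
have d0 : 0 <= d by lra.
have k0 : 0 < e ^+ 2 / 8 by rewrite divr_gt0// exprn_gt0.
have [n dn] : exists n, d ^+ n <= e ^+ 2 / 8.
  have /cvgr0Pnorm_lt/(_ _ k0)[n _ /(_ n (leqnn n))] : (GRing.exp d : R ^nat) @ \oo --> 0.
    by apply: cvg_expr; rewrite ger0_norm.
  by rewrite ger0_norm ?exprn_ge0// => /ltW; exists n.
have y1 t : rnorm (y t) <= 1.
  by rewrite yn ler_pdivrMr// mul1r; exact: rnorm_le_sup_norm.
have yt0 : y t0 = 1 by rewrite -[y t0]/((f t0)^-1 * f t0) mulVf.
have By : B y by exact: algebraZ.
have [g [Bg g1 gt0 gcone gU]] := peak_sqrt_iter n By y1 yt0 b01 yb dhalf db (ltW d1).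
have dn0 : 0 <= d ^+ n by rewrite exprn_ge0.
have lE t : rnorm (g t) ^+ 2 =
    1 - 2 * complex.Re (1 - g t) + rnorm (1 - g t) ^+ 2.
  by rewrite -sqr_rnorm_one_sub subKr.
exists g; split=> // t => [|Ut].
  have [c1 c2] := gcone t; apply: stolz_of_cone (e01) dn0 _ _ c1 _ (lE t).
  - by lra.
  - by rewrite rnorm_ge0.
  - exact: rnorm_ge0.
have [c1 c2] := gcone t; have [_ c3] := gU t Ut.
apply: small_of_cone (e01) dn0 dn _ c1 _ (lE t).
- by rewrite c3.
- exact: rnorm_ge0.
Qed.

End function_algebra_theory.

(** * Comparison of the Lipschitz numerical indices *)
Section lower_bound.
Context {R : realType} {Omega : topologicalType} {X : normedModType R[i]}.
Context {A : closed_subspace (Cb Omega X)}.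
Hypothesis A_vfs : vector_function_space A.
Local Notation B := (base_algebra A).
Implicit Types (f g h k : cs_type A) (t : Omega) (phi : Cb Omega R[i]^o).

Lemma base_algebra_comp f (xs : {linear X -> R[i]^o}) :
  (forall w, rnorm (xs w) <= rnorm w) ->
  exists2 phi, B phi & forall t, phi t = xs (ev f t).
Proof.
move=> xs1.
have cxs : continuous xs.
  by apply: (@dominated_linear_continuous _ _ _ _ 1) => w; rewrite mul1r.
have cf : continuous (ev f) by have := Cb_funP (cs_val f); rewrite inE => -[].
have w_in : (fun t => xs (ev f t)) \in @bcts R Omega R[i]^o.
  rewrite inE; split; first by move=> t; apply: continuous_comp; [exact: cf|exact: cxs].
  apply/bounded_funE; exists (rnorm f) => t.
  exact: le_trans (xs1 _) (rnorm_ev_le f t).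
exists (MkCb w_in) => //; exists (cs_val f), xs; split=> //; exact: ev_in.
Qed.

(** Composing [f] with a functional norming [ev f t] moves the question to the base algebra. *)
Lemma vector_norming f (C : R) : norming B (rho B) -> 0 <= C ->
  (forall t, rho B t -> rnorm (ev f t) <= C) -> rnorm f <= C.
Proof.
move=> norm_rho C0 fC; apply: rnorm_cs_le => // t.
have [xs [xs1 xst]] := norming_functional (ev f t).
have [phi Bphi phiE] := base_algebra_comp f xs1.
apply: (le_trans (y := rnorm phi)).
  have -> : rnorm (ev f t) = rnorm (phi t).
    by rewrite phiE xst rnorm_real ger0_norm ?rnorm_ge0.
  exact: rnorm_le_sup_norm.
rewrite norm_rho//; set E := [set _ | _ in _].
have [E0|/nonemptyPn ->] := pselect (E !=set0); last by rewrite sup0.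
apply: ge_sup => // _ [s rs <-].
by rewrite phiE (le_trans (xs1 _))// fC.
Qed.

Lemma tensor_in phi (x : X) : B phi -> exists f, forall t, ev f t = phi t *: x.
Proof. by move=> Bphi; apply: functions_of_ev; case: A_vfs => _ /(_ _ x Bphi). Qed.

Lemma module_in phi g : B phi -> exists f, forall t, ev f t = phi t *: ev g t.
Proof.
by move=> Bphi; apply: functions_of_ev; case: A_vfs => _ _; apply=> //; exact: ev_in.
Qed.

Lemma constant_in (x : X) : exists f, forall t, ev f t = x.
Proof.
have [algB _ _] := A_vfs; have [phi Bphi phi1] := algebra_cst algB 1.
by have [f fE] := tensor_in x Bphi; exists f => t; rewrite fE phi1 scale1r.
Qed.

Lemma one_sub_in phi g : B phi -> exists f, forall t, ev f t = (1 - phi t) *: ev g t.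
Proof.
move=> Bphi; have [q qE] := module_in g Bphi; exists (g - q) => t.
by rewrite evB qE scalerBl scale1r.
Qed.

(** * Increments at a strong peak point *)

Section peak_section.
Variables (T : cs_type A -> cs_type A) (phi : Cb Omega R[i]^o) (t0 : Omega) (e : R).
Hypotheses (T_lip : Lip0 T) (Bphi : B phi) (phi_t0 : phi t0 = 1) (e1 : e <= 1).
Hypothesis stolz : forall t, rnorm (phi t) + (1 - e) * rnorm (1 - phi t) <= 1.

(* The section [Psi x := phi x + (1 - e) xs(x) (1 - phi) h] of the evaluation at
   [t0] is isometric by the Stolz condition, so [S x := (T (k + Psi x) - T k)(t0)]
   satisfies [nu(S) <= nu(T)]. *)
Lemma peak_step (k k' h : cs_type A) (p : X) (lam : R) :
  rnorm h <= 1 -> rnorm p = 1 -> 0 <= lam ->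
  (forall t, ev k' t = ev k t +
     lam%:C *: (phi t *: p + ((1 - e)%:C * (1 - phi t)) *: ev h t)) ->
  lip_index X * rnorm (ev (T k' - T k) t0) <= lip_radius T * lam.
Proof.
move=> h1 p1 lam0 k'E; have [T0 lT] := T_lip.
have e0 : 0 <= 1 - e by rewrite subr_ge0.
have [xs [xs1 xsp]] := norming_functional p.
have /choice[P PE] : forall x, exists f, forall t, ev f t = phi t *: x.
  by move=> x; exact: tensor_in.
have [q qE] := one_sub_in h Bphi.
pose Psi x := P x + ((1 - e)%:C * xs x) *: q.
have PsiE x t : ev (Psi x) t = phi t *: x + ((1 - e)%:C * xs x) *: ((1 - phi t) *: ev h t).
  by rewrite /Psi evD evZ PE qE.
have PsiB x y : Psi x - Psi y = Psi (x - y).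
  apply: ev_inj => t; rewrite evB !PsiE (linearB xs)/= mulrBr; set z := (1 - _) *: _.
  rewrite scalerBl scalerBr.
  by rewrite opprD addrACA.
have Psi_t0 x : ev (Psi x) t0 = x.
  by rewrite PsiE phi_t0 subrr scale0r scaler0 addr0 scale1r.
have PsiN x : rnorm (Psi x) = rnorm x.
  apply/eqP; rewrite eq_le; apply/andP; split; last first.
    by have := rnorm_ev_le (Psi x) t0; rewrite Psi_t0.
  apply: rnorm_cs_le => [|t]; first exact: rnorm_ge0.
  rewrite PsiE (le_trans (rnormD _ _))// !rnormZ ?rnormM rnorm_real ger0_norm//.
  (* The factor in front of [rnorm x] is at most 1 by the Stolz condition. *)
  apply: (le_trans (y := (rnorm (phi t) + (1 - e) * rnorm (1 - phi t)) * rnorm x)).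
    rewrite [leRHS]mulrDl lerD2l -!mulrA ler_wpM2l// [leRHS]mulrC.
    rewrite ler_pM ?mulr_ge0 ?rnorm_ge0// ler_piMr ?rnorm_ge0//.
    exact: le_trans (rnorm_ev_le h t) h1.
  by rewrite ler_piMl// rnorm_ge0.
pose S x := ev (T (k + Psi x) - T k) t0.
have SB x y : S x - S y = ev (T (k + Psi x) - T (k + Psi y)) t0.
  by rewrite /S !evB opprB addrA subrK.
have kPsi x y : (k + Psi x) - (k + Psi y) = Psi (x - y).
  by rewrite opprD addrACA subrr add0r PsiB.
have Psi0 : Psi 0 = 0 by rewrite -(subrr (0 : X)) -PsiB subrr.
have S0 : Lip0 S.
  split; first by rewrite /S Psi0 addr0 subrr ev0.
  apply/lipschitzP; exists (lip_norm T) => [|x y]; first exact: lip_norm_ge0.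
  rewrite SB (le_trans (rnorm_ev_le _ _))// (le_trans (rnorm_le_lip_norm _ _ lT))//.
  by rewrite kPsi PsiN.
have Srad : lip_radius S <= lip_radius T.
  apply: lip_radius_le => [|x y zs xy dzs]; first exact: lip_radius_ge0.
  have xy0 : x - y != 0 by rewrite subr_eq0.
  have [zsb zsE] := duality_map_elim xy0 dzs.
  (* Evaluation at [t0] pulls [zs] back to a duality functional of [Psi (x - y)], because [Psi] is
     an isometric section. *)
  have lin : linear (fun f : cs_type A => zs (ev f t0)).
    by move=> c u v; rewrite evD evZ linearP.
  have [ys ysE] := linear_of_fun lin.
  have dys : duality_map ((k + Psi x) - (k + Psi y)) ys.
    rewrite kPsi; apply: duality_map_intro => [w|].
      rewrite ysE PsiN (le_trans (zsb _))// ler_wpM2l ?rnorm_ge0//.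
      exact: rnorm_ev_le.
    by rewrite ysE PsiN Psi_t0.
  have := rnorm_le_lip_radius lT dys.
  by rewrite ysE -SB kPsi PsiN.
have xsl : xs (lam%:C *: p) = lam%:C by rewrite linearZ/= xsp p1 /GRing.scale/= mulr1.
have k'S : ev (T k' - T k) t0 = S (lam%:C *: p) - S 0.
  rewrite SB Psi0 addr0; congr (ev (T _ - _) _); apply: ev_inj => t.
  rewrite k'E evD PsiE xsl scalerDr !scalerA.
  by congr (_ + (_ *: _ + _ *: _)); [rewrite mulrC|rewrite mulrA [X in X * _]mulrC].
have step : rnorm (S (lam%:C *: p) - S 0) <= lip_norm S * lam.
  rewrite (le_trans (rnorm_le_lip_norm _ _ S0.2))// subr0 rnormZr p1 mulr1.
  by rewrite ger0_norm.
rewrite k'S (le_trans (ler_wpM2l lip_index_ge0 step))// mulrA ler_wpM2r//.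
exact: le_trans (lip_index_mul_norm_le S0) Srad.
Qed.
End peak_section.

Lemma unit_direction (x : X) : (exists z : X, z != 0) ->
  exists2 p : X, rnorm p = 1 & x = (rnorm x)%:C *: p.
Proof.
have norm1 (z : X) : z != 0 -> rnorm ((rnorm z)^-1%:C *: z) = 1.
  move=> z0; have zp : 0 < rnorm z by rewrite rnorm_gt0.
  by rewrite rnormZr ger0_norm ?invr_ge0 ?rnorm_ge0// mulVf// gt_eqF.
move=> [z z0]; have [->|x0] := eqVneq x 0.
  by exists ((rnorm z)^-1%:C *: z); rewrite ?norm1// rnorm0 scale0r.
have xp : 0 < rnorm x by rewrite rnorm_gt0.
exists ((rnorm x)^-1%:C *: x); first exact: norm1.
by rewrite scalerA -rmorphM mulfV ?scale1r// gt_eqF.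
Qed.

(* [phi x0 + (1 - e)(1 - phi) h] is close to [h] where either [h] is close to
   [x0] or [phi] is small. *)
Lemma peak_approx_le (e : R) (c : R[i]) (x0 x : X) : 0 <= e <= 1 ->
  rnorm (c : R[i]^o) <= 1 -> rnorm x0 <= 1 -> rnorm x <= 1 ->
  rnorm (x0 - x) <= e \/ rnorm (c : R[i]^o) <= e ->
  rnorm (c *: x0 + ((1 - e)%:C * (1 - c)) *: x - x) <= e * 4.
Proof.
move=> /andP[e0 e1] c1 x01 x1 h.
have -> : c *: x0 + ((1 - e)%:C * (1 - c)) *: x - x =
    c *: (x0 - x) - (e%:C * (1 - c)) *: x.
  have -> : (1 - e)%:C * (1 - c) = (1 - c) - e%:C * (1 - c).
    by rewrite rmorphB rmorph1; ring.
  rewrite [in LHS]scalerBl scalerBl scale1r scalerBr -!addrA; congr (_ + _).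
  by rewrite !addrA [x - _]addrC addrAC addrK.
rewrite (le_trans (rnormB_le _ _))// !rnormZ ?rnormM rnorm_real ger0_norm//.
have cc : rnorm (1 - c : R[i]^o) <= 2.
  by rewrite (le_trans (rnormB_le _ _))// rnorm1 -[2]/(1 + 1) lerD2l.
have e2 : e * rnorm (1 - c : R[i]^o) * rnorm x <= e * 2.
  by rewrite -mulrA ler_wpM2l// -[leRHS]mulr1 ler_pM ?rnorm_ge0.
have -> : e * 4 = e * 2 + e * 2 by ring.
rewrite lerD//; case: h => h.
  apply: (@le_trans _ _ (1 * e)); first by rewrite ler_pM ?rnorm_ge0.
  by rewrite mul1r ler_peMr// ler1n.
rewrite ler_pM ?rnorm_ge0// (le_trans (rnormB_le _ _))// -[2]/(1 + 1) lerD//.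
Qed.

Lemma open_near_value h t0 (e : R) : open [set t | rnorm (ev h t0 - ev h t) < e].
Proof.
have ch : continuous (ev h) by have := Cb_funP (cs_val h); rewrite inE => -[].
have -> : [set t | rnorm (ev h t0 - ev h t) < e] = ev h @^-1` ball (ev h t0) e%:C.
  by apply/seteqP; split => t /=; rewrite -ball_normE /= -rnormE ltcR.
apply: open_comp => [t _|]; [exact: ch|exact: ball_open].
Qed.

(* [f - g] is a convex combination, up to [O(e)], of two increments to which
   [peak_step] applies: split [(f - g)(t0)] along [p] and [- p]. *)
Lemma peak_point_dist_le (T : cs_type A -> cs_type A) f g t0 : Lip0 T ->
  (exists z : X, z != 0) -> rho B t0 ->
  lip_index X * rnorm (ev (T f - T g) t0) <= lip_radius T * rnorm (f - g).
Proof.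
move=> T_lip X0 rt0; have [algB _ _] := A_vfs; have [T0 lT] := T_lip.
have [->|fg] := eqVneq f g.
  by rewrite !subrr !rnorm0 !mulr0.
set d := rnorm (f - g).
have d0 : 0 < d by rewrite /d rnorm_gt0 subr_eq0.
pose h := (d^-1)%:C *: (f - g).
have hN : rnorm h = 1.
  by rewrite /h rnormZr ger0_norm ?invr_ge0 ?ltW// mulVf ?gt_eqF.
have fE t : ev f t = ev g t + d%:C *: ev h t.
  by rewrite evZ scalerA -rmorphM mulfV ?gt_eqF// scale1r evB addrC subrK.
have [p p1 hp] := unit_direction (ev h t0) X0.
set r := rnorm (ev h t0) in hp.
have r0 : 0 <= r by exact: rnorm_ge0.
have r1 : r <= 1 by rewrite -hN; exact: rnorm_ev_le.
pose n := lip_index X; have n0 : 0 <= n by exact: lip_index_ge0.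
have K0 : 0 <= n * (lip_norm T * (d * 4)).
  by rewrite !mulr_ge0 ?lip_norm_ge0// ltW.
apply: (ler_of_small_perturb (ltr01 : 0 < 1 :> R) K0) => e e01.
have /andP[e0 e1] := e01.
have Ut0 : [set t | rnorm (ev h t0 - ev h t) < e] t0 by rewrite /= subrr rnorm0.
have [phi [Bphi phi1 stolz phi_small]] :=
  strong_peak_function algB rt0 (open_near_value h t0 e) Ut0 e01.
have [u uE] := tensor_in p Bphi.
have [q qE] := one_sub_in h Bphi.
(* Chosen so that the total length [lam + mu] is [d = |f - g|] while the net displacement [lam - mu]
   along [p] is [d * r], giving [(f - g)(t0)]. *)
pose lam := d * (1 + r) / 2; pose mu := d * (1 - r) / 2.
have lam0 : 0 <= lam by rewrite /lam divr_ge0// mulr_ge0 ?(ltW d0)// addr_ge0.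
have mu0 : 0 <= mu by rewrite /mu divr_ge0// mulr_ge0 ?(ltW d0)// subr_ge0.
have lammu : lam + mu = d by rewrite /lam /mu; field.
have lamBmu : lam - mu = d * r by rewrite /lam /mu; field.
(* The path goes from [g] to [k] along [- p], then to [F] along [p], ending within [4 d e] of
   [f]. *)
pose k := g + mu%:C *: (- u + (1 - e)%:C *: q).
pose F := k + lam%:C *: (u + (1 - e)%:C *: q).
have kE t : ev k t = ev g t +
    mu%:C *: (phi t *: (- p) + ((1 - e)%:C * (1 - phi t)) *: ev h t).
  by rewrite /k evD evZ evD evZ qE scalerA -[- u]sub0r evB ev0 sub0r uE scalerN.
have FE t : ev F t = ev k t +
    lam%:C *: (phi t *: p + ((1 - e)%:C * (1 - phi t)) *: ev h t).
  by rewrite /F evD evZ evD evZ qE scalerA uE.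
have h1 : rnorm h <= 1 by rewrite hN.
have pN1 : rnorm (- p) = 1 by rewrite rnormN.
have step1 := peak_step T_lip Bphi phi1 e1 stolz h1 pN1 mu0 kE.
have step2 := peak_step T_lip Bphi phi1 e1 stolz h1 p1 lam0 FE.
have FfE t : ev (F - f) t = d%:C *:
    (phi t *: ev h t0 + ((1 - e)%:C * (1 - phi t)) *: ev h t - ev h t).
  rewrite evB FE kE fE hp; set y := _ *: ev h t; set z := ev h t.
  rewrite scalerN; set P := phi t *: p.
  have -> : phi t *: (r%:C *: p) = r%:C *: P by rewrite !scalerA mulrC.
  have -> : d%:C *: (r%:C *: P + y - z) =
      (lam%:C - mu%:C) *: P + (lam%:C + mu%:C) *: y - d%:C *: z.
    by rewrite scalerBr scalerDr scalerA -rmorphM -lamBmu -rmorphB -rmorphD lammu.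
  have cancel (v1 v2 v3 v4 : X) : v1 + v2 + v3 - (v1 + v4) = v2 + v3 - v4.
    by rewrite opprD -(addrA v1) addrACA subrr add0r.
  rewrite cancel scalerBl scalerDl !scalerDr scalerN; congr (_ - _).
  by rewrite addrACA [- _ + _]addrC [mu%:C *: y + _]addrC.
have Ff : rnorm (F - f) <= d * (e * 4).
  apply: rnorm_cs_le => [|t]; first by rewrite !mulr_ge0 ?(ltW d0) ?(ltW e0).
  rewrite FfE rnormZr gtr0_norm// ler_wpM2l ?(ltW d0)//.
  apply: peak_approx_le; rewrite ?(ltW e0)//.
  - by rewrite (le_trans _ (stolz t))// lerDl mulr_ge0 ?rnorm_ge0 ?subr_ge0.
  - exact: le_trans (rnorm_ev_le h t) h1.
  - have [tU|tU] := pselect (rnorm (ev h t0 - ev h t) < e); first by left; exact: ltW.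
    by right; exact: phi_small.
have tri : rnorm (ev (T f - T g) t0) <= rnorm (ev (T f - T F) t0) +
    (rnorm (ev (T F - T k) t0) + rnorm (ev (T k - T g) t0)).
  have -> : T f - T g = (T f - T F) + ((T F - T k) + (T k - T g)).
    by rewrite !addrA !subrK.
  rewrite evD (le_trans (rnormD _ _))// lerD2l evD; exact: rnormD.
have Tf : rnorm (ev (T f - T F) t0) <= lip_norm T * (d * (e * 4)).
  rewrite (le_trans (rnorm_ev_le _ _))// (le_trans (rnorm_le_lip_norm _ _ lT))//.
  by rewrite ler_wpM2l ?lip_norm_ge0// rnorm_distC.
rewrite (le_trans (ler_wpM2l n0 tri))// !mulrDr addrC lerD//.
  by rewrite -lammu mulrDr lerD.
by rewrite (le_trans (ler_wpM2l n0 Tf))// le_eqVlt; apply/orP; left; apply/eqP; ring.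
Qed.

(** * The two inequalities between the indices *)

Lemma lip_index_function_space_ge : [set: Omega] !=set0 -> norming B (rho B) ->
  (exists z : X, z != 0) -> lip_index X <= lip_index (cs_type A).
Proof.
move=> [s _] rho_norming X0; apply: le_lip_index => [|T T_lip T1].
  have [z z0] := X0; have [f fz] := constant_in z.
  by exists f; apply: contra_neq z0 => f0; rewrite -(fz s) f0.
have [n0|n0] := eqVneq (lip_index X) 0; first by rewrite n0 lip_radius_ge0.
have n_gt0 : 0 < lip_index X by rewrite lt_def n0 lip_index_ge0.
(* Dividing by the positive index turns the goal into a bound on [lip_norm T], which may be tested
   at strong peak points. *)
rewrite -[leLHS]mulr1 -T1 -ler_pdivlMl//.
have M0 : 0 <= (lip_index X)^-1 * lip_radius T.
  by rewrite mulr_ge0 ?lip_radius_ge0// invr_ge0 ltW.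
apply: lip_norm_le => // f g.
apply: vector_norming => // [|t rt]; first by rewrite mulr_ge0 ?rnorm_ge0.
by rewrite -mulrA ler_pdivlMl//; exact: peak_point_dist_le.
Qed.

Lemma lip_index_function_space_le : [set: Omega] !=set0 -> (exists z : X, z != 0) ->
  (forall S : X -> X, Lip0 S -> [set Qop S f | f in cs_set A] `<=` functions_of A) ->
  lip_index (cs_type A) <= lip_index X.
Proof.
move=> Omega_ne X0 Q_range; apply: le_lip_index => // S S_lip S1.
have [S0 lS] := S_lip.
have /choice[T TE] : forall f, exists f', forall t, ev f' t = S (ev f t).
  move=> f; apply: functions_of_ev; apply: (Q_range S S_lip).
  by exists (cs_val f) => //; exact: ev_in.
have T_lip : Lip0 T.
  split; last exact: superposition_lipschitz TE lS.
  by apply: ev_inj => t; rewrite TE !ev0.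
have T1 : lip_norm T = 1.
  by rewrite (superposition_norm TE lS constant_in Omega_ne).
exact: le_trans (lip_index_le_radius T_lip T1) (superposition_radius_le TE lS).
Qed.

End lower_bound.

Theorem theorem3p6 (R : realType) (Omega : topologicalType)
    (X : completeNormedModType R[i]) (A : closed_subspace (Cb Omega X))
    (Omega_ne : [set: Omega] !=set0)
    (Omega_T2 : hausdorff_space Omega)
    (A_vfs : vector_function_space A)
    (rho_norming : norming (base_algebra A) (rho (base_algebra A)))
    (Q_range : forall S : X -> X, Lip0 S ->
       [set Qop S f | f in cs_set A] `<=` functions_of A) :
  lip_index X = lip_index (cs_type A).
Proof.
have [X0|X0] := pselect (exists z : X, z != 0).
  apply/eqP; rewrite eq_le lip_index_function_space_ge//.
  exact: lip_index_function_space_le.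
(* If [X] is trivial, so is the function space, and both infima are the default 0. *)
have Xz (z : X) : z = 0.
  by apply/eqP; apply: contra_notT X0 => z0; exists z.
by rewrite !lip_index_trivial// => f; apply: ev_inj => t; exact: etrans (Xz _) (esym (Xz _)).
Qed.
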